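(* Let $d>2$ and let $\Gamma\colon\mathbb{R}^d\to\mathbb{R}$ satisfy Assumption A (see context). Suppose that $\Gamma$ has a unique global minimizer $x^\star$, that it is non-degenerate, i.e. $\nabla^2\Gamma(x^\star)>0$ (positive definite), and that $\Gamma$ is normalized so that $\Gamma(x^\star)=\Gamma^\star=0$. Fix $\kappa>0$ and for $\varepsilon>0$ let $$\varrho_\varepsilon=\kappa\,\varepsilon^{1-2/d}.$$ Let $X_1,X_2,\dots$ be i.i.d. with common distribution the Gibbs measure $\pi_{\varrho_\varepsilon}$, and let $A_\varepsilon=\{y:\Gamma(y)\le\varepsilon\}$, $M_n=\min\{\Gamma(X_1),\dots,\Gamma(X_n)\}$, and, for $\delta\in(0,1)$, $$n^\star(\varepsilon,\delta)=\min\{n:\mathsf{P}\{M_n>\varepsilon\}\le\delta\},\qquad L=\log(1/\delta).$$ With $K_d(\kappa)=\mathrm{Gamma}(\tfrac d2+1)\,\kappa^{d/2}$ (Gamma denoting the Gamma function), we have $$\pi_{\varrho_\varepsilon}(A_\varepsilon)\sim\frac{\varepsilon}{K_d(\kappa)},\qquad\varepsilon\downarrow0,$$ and $$\frac{n^\star(\varepsilon,\delta)}{K_d(\kappa)L/\varepsilon}\longrightarrow1$$ for any joint limit of $(\varepsilon,\delta)$ satisfying $\varepsilon\downarrow0$ and $L/\varepsilon\to\infty$.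
   Context: Notation: $\Gamma^\star=\min_x\Gamma(x)$. For $\varrho>0$ the Gibbs measure is $\pi_\varrho(dx)=Z_\varrho^{-1}e^{-\Gamma(x)/\varrho}dx$ with $Z_\varrho=\int e^{-\Gamma(x)/\varrho}dx$. $f\sim g$ means $f/g\to1$. Assumption A on $\Gamma\colon\mathbb{R}^d\to\mathbb{R}$: (i) $\Gamma$ is $C^2$. (ii) $\Gamma$ is coercive, $\lim_{\|x\|\to\infty}\Gamma(x)/\log(1+\|x\|)=\lim_{\|x\|\to\infty}\|\nabla\Gamma(x)\|=\infty$, and $\sup_x\|\nabla^2\Gamma(x)\|<\infty$. (iii) There is a closed and bounded set $\mathcal{S}\subset\mathbb{R}^d$, equal to the closure of its interior, such that $\eta:=\inf_{x\in\mathcal{S}^c}[\Gamma(x)-\Gamma^\star]>0$, and there are positive constants $\mu_{\mathcal{S}},c_{\mathcal{S}}$ such that any solution of $\frac{d}{dt}x_t=-\nabla\Gamma(x_t)$ with $x_0\in\mathcal{S}$ satisfies $\Gamma(x_t)-\Gamma^\star\le c_{\mathcal{S}}e^{-\mu_{\mathcal{S}}t}$ for $t\ge0$. *)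

(* Defs.v *)
From HB Require Import structures.
From mathcomp Require Import all_boot all_order all_algebra finmap.
From mathcomp Require Import all_classical all_reals all_analysis.

Set Implicit Arguments.
Unset Strict Implicit.
Unset Printing Implicit Defensive.

Import Order.TTheory GRing.Theory Num.Theory.
Import numFieldNormedType.Exports.

Local Open Scope classical_set_scope.
Local Open Scope ring_scope.

(** Row vectors over [R] carry the product sigma-algebra, generated by the
    coordinate maps; this follows the instance for tuples in
    [measurable_structure] and coincides with the Borel sigma-algebra. *)
Definition measure_rV_display : measure_display. Proof. exact. Qed.

Section measurable_rV.
Context {R : realType}.
Variable n : nat.

Let coord : 'I_n -> 'rV[R]_n -> R := fun i x => x ord0 i.

Let rV_set0 : g_sigma_preimage coord set0.
Proof. exact: sigma_algebra0. Qed.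

Let rV_setC A : g_sigma_preimage coord A -> g_sigma_preimage coord (~` A).
Proof. exact: sigma_algebraC. Qed.

Let rV_bigcup (F : _^nat) : (forall i, g_sigma_preimage coord (F i)) ->
  g_sigma_preimage coord (\bigcup_i (F i)).
Proof. exact: sigma_algebra_bigcup. Qed.

HB.instance Definition _ := @isMeasurable.Build measure_rV_display
  'rV[R]_n (g_sigma_preimage coord) rV_set0 rV_setC rV_bigcup.

Lemma measurable_coord_rV (i : 'I_n) :
  measurable_fun [set: 'rV[R]_n] (fun x : 'rV[R]_n => x ord0 i).
Proof.
move=> _ Y mY; rewrite setTI; apply: sub_sigma_algebra => /=.
rewrite -bigcup_seq/=; exists i => /=; first by rewrite mem_index_enum.
by exists Y => //; rewrite setTI.
Qed.

Lemma measurable_fun_rVP d (T : measurableType d) (f : T -> 'rV[R]_n) :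
  measurable_fun [set: T] f <->
  forall i, measurable_fun [set: T] (fun t => f t ord0 i).
Proof.
split=> [mf i|mf].
  exact: (measurableT_comp (measurable_coord_rV i) mf).
move=> _; apply: (@measurability _ _ _ _ _ _
  (\big[setU/set0]_(i < n) preimage_set_system setT (coord i) measurable)) => //.
move=> _ [B + <-]; rewrite -bigcup_seq => -[i _ [C mC <-]].
by rewrite setTI preimage_setI preimage_setT setTI -[X in measurable X]setTI;
  exact: mf.
Qed.

End measurable_rV.

(** Lebesgue measure on [R^n], as the [n]-fold product of the Lebesgue measure
    on the line. *)
Section lebesgue_rV.
Context {R : realType}.

Definition consrV n (p : measurableTypeR R * 'rV[R]_n) : 'rV[R]_n.+1 :=
  \row_i oapp (p.2 ord0) p.1 (unlift ord0 i).

Lemma measurable_consrV n : measurable_fun setT (@consrV n).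
Proof.
apply/measurable_fun_rVP => i; case: (unliftP ord0 i) => [j|] ->.
  rewrite (_ : (fun _ => _) = (fun x : 'rV[R]_n => x ord0 j) \o snd).
    exact: measurableT_comp (measurable_coord_rV j) measurable_snd.
  by apply/funext => p; rewrite /consrV mxE liftK.
rewrite (_ : (fun _ => _) = fst); first exact: measurable_fst.
by apply/funext => p; rewrite /consrV mxE unlift_none.
Qed.

Section step.
Variables (n : nat) (mu : {sigma_finite_measure set 'rV[R]_n -> \bar R}).

Definition lebesgue_cons : set 'rV[R]_n.+1 -> \bar R :=
  pushforward (@lebesgue_measure R \x mu)%E (@consrV n).

Let lebesgue_cons0 : lebesgue_cons set0 = 0%E.
Proof. by rewrite /lebesgue_cons /pushforward preimage_set0 measure0. Qed.

Let lebesgue_cons_ge0 A : (0 <= lebesgue_cons A)%E.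
Proof. by rewrite /lebesgue_cons /pushforward; exact: measure_ge0. Qed.

Let lebesgue_cons_sigma_additive : semi_sigma_additive lebesgue_cons.
Proof.
move=> F mF tF mUF; rewrite /lebesgue_cons /pushforward preimage_bigcup.
have mpre A : measurable A -> measurable (@consrV n @^-1` A).
  by move=> mA; rewrite -[X in measurable X]setTI; exact: measurable_consrV.
apply: measure_semi_sigma_additive.
- by move=> k; exact: mpre.
- apply/trivIsetP => /= i j _ _ ij; rewrite -preimage_setI.
  by move/trivIsetP : tF => /(_ _ _ _ _ ij) ->//; rewrite preimage_set0.
- by rewrite -preimage_bigcup; exact: mpre.
Qed.

HB.instance Definition _ := isMeasure.Build _ _ _ lebesgue_cons
  lebesgue_cons0 lebesgue_cons_ge0 lebesgue_cons_sigma_additive.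

Let unconsrV (x : 'rV[R]_n.+1) : measurableTypeR R * 'rV[R]_n :=
  (x ord0 ord0, \row_j x ord0 (lift ord0 j)).

Let consrVK : cancel (@consrV n) unconsrV.
Proof.
move=> [a v]; rewrite /unconsrV /consrV mxE unlift_none/=; congr pair.
by apply/rowP => j; rewrite !mxE liftK.
Qed.

Let measurable_unconsrV : measurable_fun setT unconsrV.
Proof.
apply/measurable_fun_pairP; split; first exact: measurable_coord_rV.
apply/measurable_fun_rVP => i.
rewrite (_ : (fun _ => _) = fun x : 'rV[R]_n.+1 => x ord0 (lift ord0 i)).
  exact: measurable_coord_rV.
by apply/funext => x; rewrite /= mxE.
Qed.

Let lebesgue_cons_sigma_finite : sigma_finite setT lebesgue_cons.
Proof.
have /sigma_finiteP[F [TF ndF Foo]] := sigma_finiteT (@lebesgue_measure R).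
have /sigma_finiteP[G [TG ndG Goo]] := sigma_finiteT mu.
exists (fun k => unconsrV @^-1` (F k `*` G k)).
  apply/esym/seteqP; split=> // x _.
  have [k _ Fk] : (\bigcup_i F i) (unconsrV x).1 by rewrite -TF.
  have [l _ Gl] : (\bigcup_i G i) (unconsrV x).2 by rewrite -TG.
  exists (maxn k l) => //; split.
    by move: Fk; exact/subsetPset/ndF/leq_maxl.
  by move: Gl; exact/subsetPset/ndG/leq_maxr.
move=> k; have [mF Fk] := Foo k; have [mG Gk] := Goo k; split.
  rewrite -[X in measurable X]setTI; apply: measurable_unconsrV => //.
  exact: measurableX.
rewrite /lebesgue_cons /pushforward -comp_preimage.
rewrite (_ : unconsrV \o @consrV n = id); last by apply/funext => p; exact: consrVK.
by rewrite preimage_id product_measure1E// lte_mul_pinfty// ge0_fin_numE.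
Qed.

HB.instance Definition _ := Measure_isSigmaFinite.Build _ _ _ lebesgue_cons
  lebesgue_cons_sigma_finite.

End step.

Fixpoint lebesgue_rV n : {sigma_finite_measure set 'rV[R]_n -> \bar R} :=
  match n with
  | 0 => \d_(0 : 'rV[R]_0)
  | m.+1 => lebesgue_cons (lebesgue_rV m)
  end.

Lemma lebesgue_rV_box n (A : 'I_n -> set R) :
  (forall i, measurable (A i)) ->
  lebesgue_rV n [set x | forall i, A i (x ord0 i)] =
  (\prod_(i < n) lebesgue_measure (A i))%E.
Proof.
elim: n A => [|n IHn] A mA.
  by rewrite big_ord0 /= diracE mem_set//= => -[].
rewrite big_ord_recl /= /lebesgue_cons /pushforward.
have mB : measurable [set x : 'rV[R]_n | forall i, A (lift ord0 i) (x ord0 i)].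
  rewrite [X in measurable X](_ : _ = \bigcap_(i in [set: 'I_n])
    ((fun x : 'rV[R]_n => x ord0 i) @^-1` A (lift ord0 i))).
    apply: fin_bigcap_measurable => // i _.
    by rewrite -[X in measurable X]setTI; exact: measurable_coord_rV.
  by apply/seteqP; split=> [x Ax i _|x Ax i]; exact: Ax.
have -> : @consrV n @^-1` [set x | forall i, A i (x ord0 i)] =
    A ord0 `*` [set x : 'rV[R]_n | forall i, A (lift ord0 i) (x ord0 i)].
  apply/seteqP; split=> -[a v] /=.
    move=> Av; split=> [|i].
      by have := Av ord0; rewrite mxE unlift_none.
    by have := Av (lift ord0 i); rewrite mxE liftK.
  move=> [Aa Av] i; rewrite mxE.
  by case: (unliftP ord0 i) => [j|] -> /=; rewrite ?liftK ?unlift_none.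
rewrite product_measure1E//; last exact: mA.
by congr (_ * _)%E; exact: IHn.
Qed.

End lebesgue_rV.

Section calculus.
Context {R : realType} {d : nat}.
Implicit Types (f : 'rV[R]_d -> R) (x : 'rV[R]_d).

Definition basis (i : 'I_d) : 'rV[R]_d := delta_mx ord0 i.

(** Euclidean norm: the library norm on matrices is the max norm. *)
Definition enorm x : R := Num.sqrt (\sum_(i < d) x ord0 i ^+ 2).

Definition opnorm (A : 'M[R]_d) : R :=
  sup [set enorm (v *m A) | v in [set v | enorm v <= 1]].

Definition partial (i : 'I_d) f : 'rV[R]_d -> R := fun x => 'D_(basis i) f x.

Definition grad f x : 'rV[R]_d := \row_i partial i f x.

Definition hess f x : 'M[R]_d := \matrix_(i, j) partial i (partial j f) x.

Definition C1 f : Prop :=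
  continuous f /\
  forall i, (forall x, derivable f x (basis i)) /\ continuous (partial i f).

Definition C2 f : Prop := C1 f /\ forall i, C1 (partial i f).

Definition posdef (A : 'M[R]_d) : Prop :=
  forall v : 'rV[R]_d, v != 0 -> 0 < (v *m A *m v^T) ord0 ord0.

Definition enorm_infty : set_system 'rV[R]_d :=
  [set A | exists r, forall x, r < enorm x -> A x].

Global Instance enorm_infty_filter : Filter enorm_infty.
Proof.
split; first by exists 0.
- move=> A B [r Ar] [s Bs]; exists (Num.max r s) => x.
  by rewrite gt_max => /andP[rx sx]; split; [exact: Ar|exact: Bs].
- by move=> A B AB [r Ar]; exists r => x rx; apply: AB; exact: Ar.
Qed.

(** [min_value f] is the minimum of [f] whenever it is attained, which
    coercivity and continuity guarantee. *)
Definition min_value f : R := inf (range f).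

Definition unique_global_minimizer f x : Prop :=
  (forall y, f x <= f y) /\
  (forall z, (forall y, f z <= f y) -> z = x).

(** Solutions for [t >= 0]; the one-sided equation at [t = 0] follows by
    continuity. *)
Definition gradient_flow f (x : R -> 'rV[R]_d) : Prop :=
  {within `[0, +oo[, continuous x} /\
  forall t : R, 0 < t -> is_derive t (1 : R) x (- grad f (x t)).

Definition coercive f : Prop :=
  [/\ f x / ln (1 + enorm x) @[x --> enorm_infty] --> +oo,
      enorm (grad f x) @[x --> enorm_infty] --> +oo &
      has_ubound (range (fun x => opnorm (hess f x)))].

Definition exponential_descent_region f (S : set 'rV[R]_d) : Prop :=
  [/\ closed S, bounded_set S, S = closure (interior S),
      0 < inf [set f x - min_value f | x in ~` S] &
      exists mu c : R, [/\ 0 < mu, 0 < c &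
        forall x : R -> 'rV[R]_d, gradient_flow f x -> S (x 0) ->
        forall t, 0 <= t -> f (x t) - min_value f <= c * expR (- mu * t)]].

Definition assumptionA f : Prop :=
  [/\ C2 f, coercive f & exists S, exponential_descent_region f S].

End calculus.

(** Euler's Gamma function on the positive half-line. *)
Definition euler_gamma {R : realType} (s : R) : R :=
  \int[lebesgue_measure]_(t in `]0%R, +oo[) (t `^ (s - 1) * expR (- t)).

Section gibbs.
Context {R : realType} {d : nat}.
Variable f : 'rV[R]_d -> R.

Definition partition_function (rho : R) : R :=
  \int[lebesgue_rV d]_x expR (- f x / rho).

Definition gibbs (rho : R) (A : set 'rV[R]_d) : \bar R :=
  ((partition_function rho)^-1%:E *
   \int[lebesgue_rV d]_(x in A) (expR (- f x / rho))%:E)%E.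

End gibbs.

Section iid.
Context d d' (Omega : measurableType d) (T : measurableType d').
Context (R : realType) (P : probability Omega R).

Definition mutually_independent (X : nat -> {RV P >-> T}) : Prop :=
  forall (J : {fset nat}) (B : nat -> set T),
    (forall i, measurable (B i)) ->
    P (\bigcap_(i in [set` J]) (X i @^-1` B i)) =
    (\prod_(i <- J) P (X i @^-1` B i))%E.

Definition iid (X : nat -> {RV P >-> T}) (law : set T -> \bar R) : Prop :=
  (forall i A, measurable A -> distribution P (X i) A = law A) /\
  mutually_independent X.

(** The sequence [X_1, X_2, ...] is indexed from [0], and the minimum over no
    sample is [+oo]. *)
Definition sample_min (f : T -> R) (X : nat -> {RV P >-> T}) (n : nat)
    (w : Omega) : \bar R :=
  \big[Order.min/+oo%E]_(i < n) (f (X i w))%:E.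

Definition sample_size_suffices (f : T -> R) (X : nat -> {RV P >-> T})
    (e dl : R) (n : nat) : Prop :=
  (P [set w | (e%:E < sample_min f X n w)%E] <= dl%:E)%E.

(** The least sufficient [n], with the dummy value [0] if there is none; [0]
    itself is never sufficient when [dl < 1]. *)
Definition nstar (f : T -> R) (X : nat -> {RV P >-> T}) (e dl : R) : nat :=
  match pselect (exists n, `[< sample_size_suffices f X e dl n >]) with
  | left suff => ex_minn suff
  | right _ => 0
  end.

End iid.

Definition rho_eps {R : realType} (d : nat) (kappa e : R) : R :=
  kappa * e `^ (1 - 2 / d%:R).

Definition K_const {R : realType} (d : nat) (kappa : R) : R :=
  euler_gamma (d%:R / 2 + 1) * kappa `^ (d%:R / 2).

(* Main.v *)
(** Let V(s) be the volume of the sublevel set {Gamma <= s} and a = d/2. Near the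
    minimizer Gamma is squeezed between multiples (1 -+ e) q of the Hessian form q,
    and the volume of {q <= s} is exactly c s^a with c = vol {q <= 1}; hence
    V(s) ~ c s^a as s -> 0. Logarithmic growth gives V(s) <= C s^a e^s for all s.
    By Tonelli the partition function is Z(rho) = int_0^oo V(rho t) e^(-t) dt, so
    dominated convergence yields Z(rho) ~ c Gamma_E(a + 1) rho^a, with Gamma_E
    Euler's function. On {Gamma <= eps} the Gibbs weight tends uniformly to 1,
    because eps / rho_eps -> 0, so the probability p of this set is equivalent to
    V(eps) / Z(rho_eps). The constant c cancels: neither the determinant of the
    Hessian nor the volume of the unit ball is needed. Finally
    P(M_n > eps) = (1 - p)^n forces L / l <= n* <= L / l + 1 with l = - ln (1 - p). *)

Require Import Defs.
From mathcomp Require Import all_boot all_order all_algebra finmap.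
From mathcomp Require Import all_classical all_reals all_analysis.
From mathcomp Require Import measurable_realfun.
From mathcomp Require Import ring lra.

Import Order.TTheory GRing.Theory Num.Theory.
Import numFieldNormedType.Exports.

Set Implicit Arguments.
Unset Strict Implicit.

Local Open Scope classical_set_scope.
Local Open Scope ring_scope.

(** * Lebesgue measure on row vectors *)

Lemma coord_le_norm (R : realType) n (x : 'rV[R]_n) i : `|x ord0 i| <= `|x|.
Proof.
rewrite [leRHS]/Num.norm /= mx_normrE.
by apply: (le_trans _ (le_bigmax _ _ (ord0, i))).
Qed.

Lemma norm_le_coord (R : realType) n (x : 'rV[R]_n) a :
  0 <= a -> (forall i, `|x ord0 i| <= a) -> `|x| <= a.
Proof.
move=> a0 xa; rewrite [leLHS]/Num.norm /= mx_normrE.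
by apply: bigmax_le => // -[i j] _ /=; rewrite ord1.
Qed.

Lemma measurable_affine_rV (R : realType) n (a : 'rV[R]_n) (r : R) :
  measurable_fun setT (fun x : 'rV[R]_n => a + r *: x).
Proof.
apply/measurable_fun_rVP => i.
rewrite (_ : (fun _ => _) = fun x : 'rV[R]_n => a ord0 i + r * x ord0 i).
  apply: measurable_funD => //; apply: measurable_funM => //.
  exact: measurable_coord_rV.
by apply/funext => x; rewrite !mxE.
Qed.

(** Lebesgue measure is unique, so comparing on half-open intervals suffices; since [r] is positive,
    their preimages are again half-open intervals. *)
Lemma lebesgue_measure_affine (R : realType) (a r : R) (A : set R) :
  0 < r -> measurable A ->
  (r%:E * lebesgue_measure ((fun x => (a + r * x)%R) @^-1` A))%E = lebesgue_measure A.
Proof.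
move=> r0 mA.
have mf : measurable_fun setT (fun x : measurableTypeR R => a + r * x : measurableTypeR R).
  by apply: measurable_funD => //; apply: measurable_funM.
have := @lebesgue_measure_unique R (mscale (NngNum (ltW r0)) (pushforward lebesgue_measure _)).
move=> /(_ _ mf _ A mA) E; apply: esym; apply: etrans (E _) _ => //.
move=> _ [[x y] _ <-]; rewrite /mscale /pushforward [RHS]/=.
rewrite [X in _ = (_ * X)%E](_ : _ =
    lebesgue_measure `](x - a) / r, (y - a) / r]%classic); last first.
  congr (lebesgue_measure _).
  apply/seteqP; split=> z /=; rewrite !in_itv /= ltr_pdivrMr// ler_pdivlMr//;
    by rewrite ltrBlDl lerBrDl (mulrC z).
rewrite !lebesgue_measure_itv/= !lte_fin ltr_pM2r ?invr_gt0// ltrD2r.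
case: ifPn => _; last by rewrite mule0.
by rewrite -EFinM; congr EFin; field; exact: lt0r_neq0.
Qed.

(* Both sides are measures of the coordinate splitting R x R^n, so it suffices
   to compare them on rectangles. *)
Lemma lebesgue_rV_affine (R : realType) n (a : 'rV[R]_n) (r : R) A :
  0 < r -> measurable A ->
  ((r ^+ n)%:E * lebesgue_rV n ((fun x => (a + r *: x)%R) @^-1` A))%E =
  lebesgue_rV n A.
Proof.
move=> r0; elim: n a A => [|n IHn] a A mA.
  by rewrite mul1e (_ : (fun _ => _) = id)//; apply/funext => x; apply/rowP => -[].
rewrite /= /lebesgue_cons /pushforward.
pose a' : 'rV[R]_n := \row_j a ord0 (lift ord0 j).
pose f (p : measurableTypeR R * 'rV[R]_n) : measurableTypeR R * 'rV[R]_n :=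
  (a ord0 ord0 + r * p.1, a' + r *: p.2).
have mf1 : measurable_fun setT (fun x : measurableTypeR R => a ord0 ord0 + r * x : measurableTypeR R).
  by apply: measurable_funD => //; apply: measurable_funM.
have mf : measurable_fun setT f.
  apply/measurable_fun_pairP; split.
    exact: (measurableT_comp mf1 measurable_fst).
  exact: (measurableT_comp (@measurable_affine_rV _ _ _ _) measurable_snd).
have cf : (fun x : 'rV[R]_n.+1 => a + r *: x) \o @consrV _ n = @consrV _ n \o f.
  apply/funext => -[x v]; apply/rowP => i; rewrite /= !mxE.
  by case: (unliftP ord0 i) => [j|] -> /=; rewrite ?liftK ?unlift_none//= !mxE.
rewrite -[X in (_ * _ X)%E]comp_preimage cf comp_preimage.
have rn0 : 0 <= r ^+ n.+1 by rewrite exprn_ge0 // ltW.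
have := @product_measure_unique _ _ _ _ R lebesgue_measure (lebesgue_rV n)
  (mscale (NngNum rn0) (pushforward (lebesgue_measure \x lebesgue_rV n)%E f)).
move=> /(_ mf _ (@consrV _ n @^-1` A)) E; rewrite E => {E}//; last first.
  by rewrite -[X in measurable X]setTI; exact: measurable_consrV.
move=> B C mB mC; rewrite /mscale /pushforward.
rewrite [X in ((_ * X)%E = _)](_ : _ = (lebesgue_measure \x lebesgue_rV n)%E
    (((fun x => a ord0 ord0 + r * x) @^-1` B) `*`
     ((fun x => a' + r *: x) @^-1` C)))//.
have mB' : measurable ((fun x => a ord0 ord0 + r * x) @^-1` B).
  by rewrite -[X in measurable X]setTI; exact: mf1.
have mC' : measurable ((fun x => a' + r *: x) @^-1` C).
  by rewrite -[X in measurable X]setTI; exact: measurable_affine_rV.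
rewrite [X in (X * _)%E = _](_ : _ = (r * r ^+ n)%:E)%E; last by rewrite -exprS.
rewrite product_measure1E// EFinM muleACA.
rewrite lebesgue_measure_affine//.
by congr (_ * _)%E; exact: IHn.
Qed.

Lemma ratr_approx (R : realType) (x t : R) :
  0 < t -> exists q : rat, `|x - ratr q| < t.
Proof.
move=> t0; have /rat_in_itvoo[q] : x - t < x + t by lra.
by rewrite in_itv/= => /andP[h1 h2]; exists q; rewrite ltr_norml; lra.
Qed.

(** The sigma-algebra is generated by coordinates, so an open set is written as a countable union of
    balls with rational center; in the max norm each ball is a finite intersection of coordinate
    preimages. *)
Lemma open_measurable_rV (R : realType) n (U : set 'rV[R]_n) :
  open U -> measurable U.
Proof.
move=> oU.
pose c (q : 'rV[rat]_n * nat) : 'rV[R]_n := map_mx ratr q.1.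
have -> : U = \bigcup_(q in [set q | ball (c q) q.2.+1%:R^-1 `<=` U])
    ball (c q) q.2.+1%:R^-1.
  apply/seteqP; split => [x Ux|x [q qU]]; last exact: qU.
  have /nbhs_ballP[e /= e0 xeU] : nbhs x U by exact: open_nbhs_nbhs.
  (* A ball of radius below [e / 2] that contains [x] stays inside the ball of radius [e] around
     [x]. *)
  have [k ke] : exists k : nat, 2 * k.+1%:R^-1 < e.
    have e20 : 0 < e / 2 by rewrite divr_gt0.
    have [k _ /(_ k (leqnn k))] := near_infty_natSinv_lt (PosNum e20).
    by rewrite /= ltr_pdivlMr// mulrC; exists k.
  have k0 : 0 < k.+1%:R^-1 :> R by rewrite invr_gt0.
  have qex i : exists q : rat, `|x ord0 i - ratr q| < k.+1%:R^-1.
    exact: ratr_approx.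
  pose q := (\row_i projT1 (cid (qex i)), k).
  have xq : ball (c q) k.+1%:R^-1 x.
    split=> // i j; rewrite (ord1 i) !mxE; have := projT2 (cid (qex j)).
    by rewrite distrC.
  exists q => //= y qy; apply: xeU; apply: (le_ball (ltW ke)).
  rewrite mulr_natl mulr2n; apply: ball_triangle qy.
  exact: ball_sym.
rewrite bigcup_mkcond; apply: countable_bigcupT_measurable => // q.
case: ifP => // _.
have -> : ball (c q) q.2.+1%:R^-1 = \bigcap_(i in [set: 'I_n])
    ((fun x : 'rV[R]_n => x ord0 i) @^-1` ball (c q ord0 i) q.2.+1%:R^-1).
  apply/seteqP; split => x /= => [[_ h] i _|h]; first exact: h.
  by split=> // i j; rewrite (ord1 i); exact: (h j).
apply: fin_bigcap_measurable => // i _.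
rewrite -[X in measurable X]setTI; apply: measurable_coord_rV => //.
exact: measurable_ball.
Qed.

Lemma continuous_measurable_rV (R : realType) n (f : 'rV[R]_n -> R) :
  continuous f -> measurable_fun setT f.
Proof.
move=> cf; apply: (measurability _ (RGenOpens.measurableE R)).
move=> _ [_ [a [b ->]] <-]; rewrite setTI; apply: open_measurable_rV.
by apply: open_comp => [x _|]; [exact: cf|exact: interval_open].
Qed.

(** * Second-order expansion at a minimizer *)

Lemma is_derive_line (R : realType) n (f : 'rV[R]_n -> R) (y v : 'rV[R]_n) (t : R) :
  derivable f (y + t *: v) v ->
  is_derive t (1 : R) (fun s : R => f (y + s *: v)) ('D_v f (y + t *: v)).
Proof.
have E : (fun h : R => h^-1 *: (((fun s : R => f (y + s *: v)) \o shift t) (h *: 1) -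
    f (y + t *: v))) =
    (fun h : R => h^-1 *: ((f \o shift (y + t *: v)) (h *: v) - f (y + t *: v))).
  apply/funext => h /=; congr (_ *: (f _ - _)).
  by rewrite -[h%:A]/(h * 1) mulr1 scalerDl addrCA.
move=> df; apply: DeriveDef; first by rewrite /derivable E.
by rewrite /derive E.
Qed.

(** Turns a little-o estimate into a derivative, so that the expansion in several variables can be
    restricted to lines. *)
Lemma is_derive_first_order (R : realType) (g : R -> R) (t l : R) :
  (forall e : R, 0 < e -> exists2 r : R, 0 < r &
    forall s, `|s| < r -> `|g (t + s) - g t - s * l| <= e * `|s|) ->
  is_derive t (1 : R) g l.
Proof.
move=> H.
have C : (fun h : R => h^-1 *: ((g \o shift t) (h *: 1) - g t)) h @[h --> 0^'] --> l.
  apply/cvgrPdist_le => e e0; have [r r0 rH] := H _ e0; near=> h.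
  have h0 : h != 0 by near: h; exact: nbhs_dnbhs_neq.
  have hr : `|h| < r by near: h; apply: dnbhs0_lt.
  rewrite -(ler_pM2r (_ : 0 < `|h|)) ?normr_gt0// -normrM.
  rewrite -normrN; apply: le_trans (rH _ hr); rewrite le_eqVlt; apply/orP; left.
  apply/eqP; congr (`|_|).
  rewrite /= -[h%:A]/(h * 1) mulr1 -[h^-1 *: _]/(h^-1 * _) (addrC h t).
  by field.
apply: DeriveDef; first by apply/cvg_ex; exists l.
exact/cvg_lim.
Unshelve. all: by end_near. Qed.

Lemma MVT01 (R : realType) (g dg : R -> R) :
  (forall t, is_derive t (1 : R) g (dg t)) ->
  exists2 t, 0 <= t <= 1 & g 1 - g 0 = dg t.
Proof.
move=> dgP; have [|c] := @MVT_segment R g dg 0 1 ler01 (fun x _ => dgP x).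
  apply: derivable_within_continuous => x _; exact: ex_derive.
by rewrite in_itv/= subr0 mulr1 => cI ->; exists c.
Qed.

(** The segment is parametrized by [u] in [0, 1] through [s * u], which treats both signs of [s] at
    once. *)
Lemma partial_MVT (R : realType) n (f : 'rV[R]_n -> R) (i : 'I_n) y (s : R) :
  (forall x, derivable f x (Defs.basis i)) ->
  exists2 t : R, `|t| <= `|s| &
    f (y + s *: Defs.basis i) - f y = s * partial i f (y + t *: Defs.basis i).
Proof.
move=> df.
pose g (u : R) := f (y + (s * u) *: Defs.basis i).
have dg u : is_derive u (1 : R) g (s * partial i f (y + (s * u) *: Defs.basis i)).
  have D := is_derive_line (df (y + (s * u) *: Defs.basis i)).
  have D2 : is_derive u (1 : R) ( *%R s) s.
    rewrite (_ : *%R s = s \*: (@id R))//.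
    have := @is_deriveZ R R R id s u 1 1 (is_derive_id _ _).
    by rewrite /= -[s *: 1]/(s * 1) mulr1.
  have := @is_derive1_comp R (fun a => f (y + a *: Defs.basis i)) ( *%R s) u _ _ D D2.
  by rewrite mulrC.
have [t /andP[t0 t1] tE] := MVT01 dg.
exists (s * t).
  by rewrite normrM ler_piMr// ger0_norm.
by move: tE; rewrite /g mulr1 mulr0 scale0r addr0.
Qed.

Lemma norm_basis_scale (R : realType) n (i : 'I_n) (t : R) (v : 'rV[R]_n) a :
  0 <= a -> `|t| <= a -> (forall j, j != i -> `|v ord0 j| <= a) -> v ord0 i = 0 ->
  `|v + t *: Defs.basis i| <= a.
Proof.
move=> a0 ta va vi; apply: norm_le_coord => // j; rewrite !mxE eqxx /=.
have [->|ji] := eqVneq j i; first by rewrite vi add0r mulr1.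
by rewrite mulr0 addr0 va.
Qed.

Lemma sum_div_succ_le (R : realType) n (a e : R) : 0 <= a -> 0 <= e ->
  \sum_(i < n) a * (e / n.+1%:R) <= a * e.
Proof.
move=> a0 e0; rewrite sumr_const card_ord -[leLHS]mulr_natr -mulrA ler_wpM2l//.
by rewrite mulrAC ler_pdivrMr// ler_wpM2l// ler_nat.
Qed.

(* Change one coordinate at a time and apply the mean value theorem to each
   increment. *)
Lemma C1_first_order (R : realType) n (f : 'rV[R]_n -> R) (x : 'rV[R]_n) (e : R) :
  C1 f -> 0 < e -> exists2 r : R, 0 < r &
  forall h : 'rV[R]_n, `|h| < r ->
    `|f (x + h) - f x - \sum_i h ord0 i * partial i f x| <= e * `|h|.
Proof.
move=> [_ C1f] e0.
(* The share of the error allowed to each of the [n] coordinates; [n.+1] keeps the divisor nonzero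
   in dimension 0. *)
have en0 : 0 < e / n.+1%:R by rewrite divr_gt0.
have [r r0 rP] : exists2 r : R, 0 < r & forall i y, `|y - x| < r ->
    `|partial i f y - partial i f x| <= e / n.+1%:R.
  have : \forall y \near x, forall i, `|partial i f x - partial i f y| <= e / n.+1%:R.
    apply: (@filter_forall _ _ (fun i y =>
      `|partial i f x - partial i f y| <= e / n.+1%:R) (nbhs x)) => i.
    have [_ ci] := C1f i.
    by have /cvgrPdist_le/(_ _ en0) := ci x.
  move=> /nbhs_normP[r /= r0 rP]; exists r => // i y yx.
  by rewrite distrC; apply: rP; rewrite /ball_/= distrC.
exists r => // h hr.
pose hk (k : nat) : 'rV[R]_n := \row_i (if (i < k)%N then h ord0 i else 0).
have hn : h = hk n by apply/rowP => i; rewrite mxE ltn_ord.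
have h0 : hk 0%N = 0 by apply/rowP => i; rewrite !mxE ltn0.
have step (i : 'I_n) : exists2 z, `|z - x| <= `|h| &
    f (x + hk i.+1) - f (x + hk i) = h ord0 i * partial i f z.
  have [df _] := C1f i.
  have [t ts tE] := partial_MVT (x + hk i) (h ord0 i) df.
  exists (x + hk i + t *: Defs.basis i).
    rewrite addrC -(addrA x) addKr.
    apply: norm_basis_scale => //.
    - exact: le_trans ts (coord_le_norm _ _).
    - by move=> j _; rewrite mxE; case: ifP => _; rewrite ?normr0// coord_le_norm.
    - by rewrite mxE ltnn.
  rewrite -tE; congr (f _ - _); rewrite -addrA; congr (_ + _).
  apply/rowP => j; rewrite !mxE eqxx /= ltnS leq_eqVlt.
  have [->|ji] := eqVneq j i; first by rewrite eqxx/= ltnn add0r mulr1.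
  by rewrite (inj_eq val_inj) (negbTE ji)/= mulr0 addr0.
have -> : f (x + h) - f x = \sum_(i < n) (f (x + hk i.+1) - f (x + hk i)).
  by rewrite -(big_mkord xpredT (fun i => f (x + hk i.+1) - f (x + hk i)))
    telescope_sumr// h0 addr0 -hn.
rewrite -sumrB; apply: (le_trans (ler_norm_sum _ _ _)).
apply: (@le_trans _ _ (\sum_(i < n) `|h| * (e / n.+1%:R))).
  apply: ler_sum => i _; have [z zx ->] := step i.
  rewrite -mulrBr normrM ler_pM// ?coord_le_norm// rP//.
  exact: le_lt_trans zx hr.
by rewrite [leRHS]mulrC sum_div_succ_le// ltW.
Qed.

Lemma C1_is_derive_line (R : realType) n (f : 'rV[R]_n -> R) (x v : 'rV[R]_n) t :
  C1 f -> is_derive t (1 : R) (fun s : R => f (x + s *: v))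
    (\sum_i v ord0 i * partial i f (x + t *: v)).
Proof.
move=> C1f; apply: is_derive_first_order => e e0.
(* Adding 1 to the norm of [v] keeps the divisions below legitimate when [v = 0]. *)
have v0 : 0 < `|v| + 1 by rewrite ltr_wpDl.
have ev0 : 0 < e / (`|v| + 1) by rewrite divr_gt0.
have [r r0 rP] := C1_first_order (x + t *: v) C1f ev0.
exists (r / (`|v| + 1)); first by rewrite divr_gt0.
move=> s sr.
have sv : `|s *: v| <= `|s| * (`|v| + 1) by rewrite normrZ ler_wpM2l// lerDl.
have := rP (s *: v); rewrite scalerDl addrA.
have -> : \sum_i (s *: v) ord0 i * partial i f (x + t *: v) =
    s * \sum_i v ord0 i * partial i f (x + t *: v).
  by rewrite mulr_sumr; apply: eq_bigr => i _; rewrite mxE mulrA.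
move=> H; apply: (le_trans (H _)).
  by apply: le_lt_trans sv _; rewrite -ltr_pdivlMr.
by rewrite -mulrA ler_pM2l// mulrC ler_pdivrMr.
Qed.

Lemma quad_formE (R : realType) n (H : 'M[R]_n) (h : 'rV[R]_n) :
  (h *m H *m h^T) ord0 ord0 = \sum_j h ord0 j * \sum_i h ord0 i * H i j.
Proof.
rewrite mxE; apply: eq_bigr => j _; rewrite !mxE mulrC; congr (_ * _).
Qed.

Lemma partial_minimizer (R : realType) n (f : 'rV[R]_n -> R) x i :
  C1 f -> (forall y, f x <= f y) -> partial i f x = 0.
Proof.
move=> [_ C1f] xmin; have [df _] := C1f i.
pose g (t : R) := f (x + t *: Defs.basis i).
have dg t : is_derive t (1 : R) g (partial i f (x + t *: Defs.basis i)).
  exact: is_derive_line.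
have : is_derive (0 : R) (1 : R) g 0.
  apply: (@derive1_at_min R g (-1) 1) => //; first by rewrite in_itv/= ltrN10 ltr01.
  by move=> t _; rewrite /g scale0r addr0.
move=> [_ D0]; have [_ D1] := dg 0.
by rewrite -D0 D1 scale0r addr0.
Qed.

(** The gradient vanishes at [x], so each partial derivative near [x] is a row of the Hessian form
    up to a small error; the mean value theorem along the segment from [x] to [x + h] integrates
    this. *)
Lemma C2_taylor_minimizer (R : realType) n (f : 'rV[R]_n -> R) (x : 'rV[R]_n) (e : R) :
  C2 f -> (forall y, f x <= f y) -> 0 < e -> exists2 r : R, 0 < r &
  forall h : 'rV[R]_n, `|h| < r ->
    `|f (x + h) - f x - (h *m hess f x *m h^T) ord0 ord0 / 2| <= e * `|h| ^+ 2.
Proof.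
move=> [C1f C2f] xmin e0.
have en0 : 0 < e / n.+1%:R by rewrite divr_gt0.
have [r r0 rP] : exists2 r : R, 0 < r & forall j h, `|h| < r ->
    `|partial j f (x + h) - \sum_i h ord0 i * hess f x i j| <= e / n.+1%:R * `|h|.
  have : \forall r \near (0 : R)^'+, forall j h, `|h| < r ->
    `|partial j f (x + h) - \sum_i h ord0 i * hess f x i j| <= e / n.+1%:R * `|h|.
    apply: filter_forall => j; have [r r0 rP] := C1_first_order x (C2f j) en0.
    near=> s => h hs; have := rP h; rewrite (partial_minimizer j C1f xmin) subr0.
    under [in X in _ -> X]eq_bigr do rewrite mxE.
    apply; apply: lt_le_trans hs _.
    by near: s; exact: nbhs_right_le.
  move=> H; have [r] := @filter_ex _ _ _ _ (filterI H (nbhs_right_gt 0)).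
  by move=> [H1 H2]; exists r.
exists r => // h hr; rewrite quad_formE.
set q := \sum_j _.
(* Subtracting the quadratic part leaves a function whose derivative pairs [h] with exactly the
   errors bounded in [rP]. *)
pose g (t : R) := f (x + t *: h) - q / 2 * t ^+ 2.
have dg t : is_derive t (1 : R) g (\sum_j h ord0 j * (partial j f (x + t *: h) -
    \sum_i (t *: h) ord0 i * hess f x i j)).
  have D := C1_is_derive_line x h t C1f.
  have D2 : is_derive t (1 : R) (fun t : R => q / 2 * t ^+ 2) (q * t).
    have := @is_deriveZ R R R _ (q / 2) t 1 _ (@is_deriveX R R id 2 t 1 1 (is_derive_id _ _)).
    rewrite (_ : (_ / _) *: _ = q * t) //=; last first.
      by rewrite -[LHS]/(q / 2 * (2%:R * t ^+ 1 * 1)) expr1; field.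
  have := is_deriveB D D2; congr (is_derive _ _ _ _).
  rewrite /q mulr_suml -sumrB; apply: eq_bigr => j _.
  rewrite mulrBr; congr (_ - _); rewrite -mulrA; congr (_ * _).
  rewrite mulr_suml; apply: eq_bigr => i _; rewrite [(t *: h) _ _]mxE mulrAC.
  by congr (_ * _); exact: mulrC.
have [t /andP[t0 t1]] := MVT01 dg.
rewrite /g !scale1r expr1n scale0r expr0n/= mulr0 subr0 addr0 mulr1 addrAC => ->.
apply: (le_trans (ler_norm_sum _ _ _)).
have th : `|t *: h| <= `|h| by rewrite normrZ ler_piMl// ger0_norm.
apply: (@le_trans _ _ (\sum_(j < n) `|h| ^+ 2 * (e / n.+1%:R))).
  apply: ler_sum => j _; rewrite normrM expr2 -mulrA [X in _ <= _ * X]mulrC.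
  rewrite ler_pM ?coord_le_norm//.
  apply: le_trans (rP _ _ (le_lt_trans th hr)) _.
  by rewrite ler_wpM2l// ltW.
by rewrite [leRHS]mulrC sum_div_succ_le ?sqr_ge0// ltW.
Unshelve. all: by end_near. Qed.

(** * Volume of the sublevel sets *)

Lemma norm_le_enorm (R : realType) n (x : 'rV[R]_n) : `|x| <= enorm x.
Proof.
apply: norm_le_coord => [|i]; first exact: sqrtr_ge0.
rewrite -sqrtr_sqr ler_sqrt; last by rewrite sumr_ge0// => j _; rewrite sqr_ge0.
by rewrite (bigD1 i)//= lerDl sumr_ge0// => j _; rewrite sqr_ge0.
Qed.

(** Transfers coercivity from the Euclidean norm to the max norm, which is the smaller one, so the
    logarithmic lower bound survives for [0 <= m]. *)
Lemma log_growth (R : realType) n (f : 'rV[R]_n -> R) (m : R) : 0 <= m ->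
  f x / ln (1 + enorm x) @[x --> enorm_infty] --> +oo ->
  exists2 r : R, 0 <= r & forall x, r < `|x| -> m * ln (1 + `|x|) <= f x.
Proof.
move=> m0 /cvgryPge/(_ m)[r rP]; exists (Num.max r 0).
  by rewrite le_max lexx orbT.
move=> x; rewrite gt_max => /andP[rx x0].
have xe := norm_le_enorm x.
have l0 : 0 < ln (1 + enorm x) by rewrite ln_gt0// ltrDl (lt_le_trans x0).
have := rP x (lt_le_trans rx xe); rewrite /= ler_pdivlMr//; apply: le_trans.
by rewrite ler_wpM2l// ler_ln ?lerD2l// posrE addr_gt0// (lt_le_trans x0).
Qed.

Lemma measurable_sublevel d (T : measurableType d) (R : realType) (f : T -> R) s :
  measurable_fun setT f -> measurable [set x | f x <= s].
Proof.
move=> mf; rewrite (_ : [set x | _] = f @^-1` `]-oo, s]).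
  by rewrite -[X in measurable X]setTI; exact: mf.
by apply/seteqP; split => x /=; rewrite in_itv.
Qed.

Lemma lebesgue_rV_ball (R : realType) n (b : R) : 0 <= b ->
  lebesgue_rV n [set x : 'rV[R]_n | `|x| <= b] = ((2 * b) ^+ n)%:E.
Proof.
move=> b0.
have -> : [set x : 'rV[R]_n | `|x| <= b] = [set x | forall i, `[- b, b]%classic (x ord0 i)].
  apply/seteqP; split => x /= H => [i|].
    by rewrite /= in_itv/= -ler_norml (le_trans (coord_le_norm x i)).
  by apply: norm_le_coord => // i; have := H i; rewrite /= in_itv/= -ler_norml.
rewrite (@lebesgue_rV_box _ n (fun=> `[- b, b]%classic))//.
rewrite (eq_bigr (fun=> (2 * b)%:E)) => [|i _].
  by rewrite prodEFin prodr_const card_ord.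
rewrite lebesgue_measure_itv/= lte_fin; case: ltP => [_|bb].
  by rewrite -EFinD opprK -mulr2n mulr_natl.
by congr EFin; lra.
Qed.

Lemma lebesgue_rV_bounded (R : realType) n (A : set 'rV[R]_n) b : 0 <= b ->
  measurable A -> (forall x, A x -> `|x| <= b) ->
  (lebesgue_rV n A <= ((2 * b) ^+ n)%:E)%E.
Proof.
move=> b0 mA Ab; rewrite -lebesgue_rV_ball//; apply: le_measure => //; rewrite inE//.
apply: measurable_sublevel; apply: continuous_measurable_rV.
exact: norm_continuous.
Qed.

(** Growth at [n.+1] times the logarithm confines the sublevel set to a cube of side of order
    [expR (s / n.+1)]; the power [n.+1] of the side is then of order [expR s]. *)
Lemma sublevel_measure_growth (R : realType) n (f : 'rV[R]_n.+1 -> R) :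
  continuous f -> f x / ln (1 + enorm x) @[x --> enorm_infty] --> +oo ->
  exists2 C : R, 0 < C & forall s, 0 <= s ->
    (lebesgue_rV n.+1 [set x | (f x <= s)%R] <= (C * expR s)%:E)%E.
Proof.
move=> cf gf; have [r r0 rP] := log_growth (ler0n R n.+1) gf.
exists ((2 * (r + 1)) ^+ n.+1) => [|s s0]; first by rewrite exprn_gt0// mulr_gt0// ltr_wpDl.
have E1 : 1 <= expR (s / n.+1%:R) by rewrite -expR0 ler_expR divr_ge0.
apply: (@le_trans _ _ ((2 * ((r + 1) * expR (s / n.+1%:R))) ^+ n.+1)%:E).
  apply: lebesgue_rV_bounded.
  - by rewrite mulr_ge0 ?expR_ge0// addr_ge0.
  - by apply: measurable_sublevel; exact: continuous_measurable_rV.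
  move=> x /= fs; have [xr|rx] := leP `|x| r.
    by rewrite (le_trans xr)// (@le_trans _ _ (r + 1)) ?lerDl// ler_peMr// addr_ge0.
  have := le_trans (rP _ rx) fs; rewrite mulrC -ler_pdivlMr//.
  have x0 : 0 < 1 + `|x| by rewrite (lt_le_trans ltr01)// lerDl.
  rewrite -ler_expR lnK ?posrE// => H.
  rewrite mulrDl mul1r (@le_trans _ _ (1 + `|x|)) ?lerDr// (le_trans H)// lerDr.
  by rewrite mulr_ge0// expR_ge0.
by rewrite mulrA exprMn -expRM_natl mulrCA divff// mulr1 lexx.
Qed.

Lemma quad_form_continuous (R : realType) n (A : 'M[R]_n) :
  continuous (fun v : 'rV[R]_n => (v *m A *m v^T) ord0 ord0 : R).
Proof.
rewrite (_ : (fun _ => _) = fun v : 'rV[R]_n => \sum_j v ord0 j * \sum_i v ord0 i * A i j).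
  apply: continuous_big => [|j _]; first exact: add_continuous.
  move=> v; apply: continuousM; first exact: coord_continuous.
  apply: continuous_big => [|i _]; first exact: add_continuous.
  by move=> w; apply: continuousM; [exact: coord_continuous|exact: cst_continuous].
by apply/funext => w; exact: quad_formE.
Qed.

Lemma quad_formZ (R : realType) n (A : 'M[R]_n) (t : R) (v : 'rV[R]_n) :
  ((t *: v) *m A *m (t *: v)^T) ord0 ord0 = t ^+ 2 * (v *m A *m v^T) ord0 ord0.
Proof.
rewrite !quad_formE mulr_sumr; apply: eq_bigr => j _.
rewrite (_ : \sum_i (t *: v) ord0 i * A i j = t * \sum_i v ord0 i * A i j).
  by rewrite mxE expr2 mulrACA.
by rewrite mulr_sumr; apply: eq_bigr => i _; rewrite mxE mulrA.
Qed.

(** The constant is the minimum of the form on the compact unit sphere of the max norm; homogeneity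
    of degree two extends the bound. *)
Lemma posdef_coercive (R : realType) n (A : 'M[R]_n) : posdef A ->
  exists2 m : R, 0 < m & forall v : 'rV[R]_n, m * `|v| ^+ 2 <= (v *m A *m v^T) ord0 ord0.
Proof.
move=> pA.
pose q (v : 'rV[R]_n) := (v *m A *m v^T) ord0 ord0.
have cq : continuous q by exact: quad_form_continuous.
have qZ (t : R) v : q (t *: v) = t ^+ 2 * q v by exact: quad_formZ.
pose S := [set v : 'rV[R]_n | `|v| = 1].
(* An empty sphere means dimension 0, where the only vector is zero. *)
have [[v0 Sv0]|nS] := pselect (exists v, S v); last first.
  exists 1 => // v; have [->|vn0] := eqVneq v 0.
    by rewrite normr0 expr0n mulr0 mul0mx mul0mx mxE.
  exfalso; apply: nS; exists (`|v|^-1 *: v); rewrite /S /=.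
  by rewrite normrZ normfV normr_id mulVf// normr_eq0.
have cS : compact S.
  apply: bounded_closed_compact.
    by exists 1; split => // M M1 v /= ->; exact: ltW.
  apply: (@preimage_closed _ _ (fun v : 'rV[R]_n => `|v|) [set x | x = 1]).
    by move=> v _; exact: norm_continuous.
  exact: closed_eq.
have [|c] := @EVT_min_rV R n q S (ex_intro _ v0 Sv0) cS.
  exact: continuous_subspaceT.
rewrite inE => Sc cmin; exists (q c).
  apply: pA; apply/eqP => c0; move: Sc; rewrite /S /= c0 normr0 => /eqP.
  by rewrite eq_sym oner_eq0.
move=> v; have [->|vn0] := eqVneq v 0.
  by rewrite normr0 expr0n mulr0 mul0mx mul0mx mxE.
have nv0 : `|v| != 0 by rewrite normr_eq0.
have -> : (v *m A *m v^T) ord0 ord0 = `|v| ^+ 2 * q (`|v|^-1 *: v).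
  by rewrite qZ mulrA -exprMn divff// expr1n mul1r.
rewrite mulrC ler_wpM2l ?sqr_ge0//; apply: cmin; rewrite inE /S /=.
by rewrite normrZ normfV normr_id mulVf.
Qed.

(** Logarithmic growth bounds [f] below by 1 outside a large ball; in the compact remainder away
    from [x] the minimum is attained, and it is positive by uniqueness of the minimizer. *)
Lemma minimizer_isolated (R : realType) n (f : 'rV[R]_n -> R) x (r : R) :
  continuous f -> f x / ln (1 + enorm x) @[x --> enorm_infty] --> +oo ->
  unique_global_minimizer f x -> f x = 0 -> 0 < r ->
  exists2 s : R, 0 < s & forall y, r <= `|y - x| -> s <= f y.
Proof.
move=> cf gf [xmin xuniq] fx0 r0.
have [b b0 bP] := log_growth ler01 gf.
(* Beyond [expR 1] the logarithm is at least 1, beyond [b] it bounds [f] from below. *)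
have far y : b + expR 1 < `|y| -> 1 <= f y.
  move=> yb; have by' : b < `|y| by rewrite (le_lt_trans _ yb)// lerDl expR_ge0.
  apply: le_trans (bP _ by'); rewrite mul1r -[leLHS]expRK ler_ln ?posrE ?expR_gt0//.
  by rewrite (@le_trans _ _ `|y|) ?lerDr// (le_trans _ (ltW yb))// lerDr.
pose K := [set y : 'rV[R]_n | r <= `|y - x|] `&` [set y | `|y| <= b + expR 1].
have [[y0 Ky0]|nK] := pselect (exists v, K v); last first.
  exists 1 => // y ry; have [yb|] := leP `|y| (b + expR 1); last exact: far.
  by exfalso; apply: nK; exists y.
have cK : compact K.
  apply: bounded_closed_compact.
    exists (b + expR 1); split => [|M M1 v /= [_ vb]]; first exact: num_real.
    exact: le_trans (ltW M1).
  apply: closedI.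
    apply: (@preimage_closed _ _ (fun v : 'rV[R]_n => `|v - x|) [set t | r <= t]).
      move=> v _; apply: (@continuous_comp _ _ _ (fun w : 'rV[R]_n => w - x) Num.norm).
        by apply: (@continuousB R); [exact: cvg_id|exact: cst_continuous].
      exact: norm_continuous.
    exact: closed_ge.
  apply: (@preimage_closed _ _ (fun v : 'rV[R]_n => `|v|) [set t | t <= b + expR 1]).
    by move=> v _; exact: norm_continuous.
  exact: closed_le.
have [|c] := @EVT_min_rV R n f K (ex_intro _ y0 Ky0) cK.
  exact: continuous_subspaceT.
rewrite inE => -[Kc _] cmin.
have fc0 : 0 < f c.
  rewrite lt_neqAle -fx0 xmin andbT; apply/eqP => E.
  have cx : c = x by apply: xuniq => y; rewrite -E; exact: xmin.
  by move: Kc; rewrite /= cx subrr normr0 leNgt r0.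
exists (Num.min 1 (f c)); first by rewrite lt_min ltr01.
move=> y ry; have [yb|yb] := leP `|y| (b + expR 1).
  by rewrite ge_min cmin ?orbT// inE.
by rewrite ge_min far.
Qed.

(** Real-valued through [fine], which sends an infinite volume to 0; the finiteness lemmas below
    exclude that case. *)
Definition sublevel_volume (R : realType) n (f : 'rV[R]_n -> R) (s : R) : R :=
  fine (lebesgue_rV n [set x | f x <= s]).

Lemma powR_half_sqrtX (R : realType) (s : R) n : 0 <= s ->
  s `^ (n%:R / 2) = Num.sqrt s ^+ n.
Proof.
by move=> s0; rewrite mulrC powRrM powR12_sqrt// powR_mulrn// sqrtr_ge0.
Qed.

Section quadratic_sublevels.
Context {R : realType} {n : nat} (q : 'rV[R]_n -> R).
Hypotheses (cq : continuous q) (qZ : forall t v, q (t *: v) = t ^+ 2 * q v).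
Variables (m : R) (m0 : 0 < m) (qm : forall v, m * `|v| ^+ 2 <= q v).

Lemma quad_sublevel_fin_num (s : R) : 0 <= s ->
  lebesgue_rV n [set x | q x <= s] \is a fin_num.
Proof.
move=> s0; rewrite ge0_fin_numE//; have sm : 0 <= s / m by rewrite divr_ge0// ltW.
apply: (@le_lt_trans _ _ ((2 * Num.sqrt (s / m)) ^+ n)%:E); last exact: ltry.
apply: lebesgue_rV_bounded; first exact: sqrtr_ge0.
  by apply: measurable_sublevel; exact: continuous_measurable_rV.
move=> x /= qs; rewrite -(ger0_norm (normr_ge0 x)) -sqrtr_sqr ler_sqrt//.
by rewrite ler_pdivlMr// mulrC (le_trans (qm x)).
Qed.

(** Dilation by the square root of [s] carries the unit sublevel set of [q] onto the one at level
    [s]. *)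
Lemma quad_sublevel_scale (s : R) : 0 < s ->
  sublevel_volume q s = s `^ (n%:R / 2) * sublevel_volume q 1.
Proof.
move=> s0; rewrite /sublevel_volume (powR_half_sqrtX _ (ltW s0)).
have r0 : 0 < Num.sqrt s by rewrite sqrtr_gt0.
rewrite -(@lebesgue_rV_affine _ _ 0 (Num.sqrt s))//; last first.
  by apply: measurable_sublevel; exact: continuous_measurable_rV.
rewrite (_ : _ @^-1` _ = [set x | q x <= 1]); last first.
  apply/seteqP; split => x /=; rewrite add0r qZ sqr_sqrtr ?(ltW s0)//;
    by have := ler_pM2l s0 (q x) 1; rewrite mulr1 => ->.
by rewrite fineM// quad_sublevel_fin_num.
Qed.

(** By continuity at 0 the unit sublevel set contains a cube of positive side. *)
Lemma quad_sublevel_gt0 : 0 < sublevel_volume q 1.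
Proof.
have q0 : q 0 = 0 by rewrite -(scale0r 0) qZ expr0n mul0r.
have [r r0 rq] : exists2 r : R, 0 < r & forall v, `|v| <= r -> q v <= 1.
  have /cvgrPdist_le/(_ _ ltr01)/nbhs_normP[r /= r0 rP] := cq (x := 0).
  exists (r / 2) => [|v vr]; first by rewrite divr_gt0.
  have : ball_ Num.norm 0 r v.
    by rewrite /ball_/= sub0r normrN (le_lt_trans vr)// ltr_pdivrMr// ltr_pMr// ltr1n.
  by move=> /rP /=; rewrite q0 sub0r normrN => /(le_trans (ler_norm _)).
rewrite /sublevel_volume -lte_fin fineK ?quad_sublevel_fin_num//.
apply: (@lt_le_trans _ _ ((2 * r) ^+ n)%:E).
  by rewrite lte_fin exprn_gt0// mulr_gt0.
rewrite -(lebesgue_rV_ball n (ltW r0)); apply: le_measure; rewrite ?inE.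
- by apply: measurable_sublevel; apply: continuous_measurable_rV; exact: norm_continuous.
- by apply: measurable_sublevel; exact: continuous_measurable_rV.
- by move=> v /= /rq.
Qed.

End quadratic_sublevels.

Lemma continuous_powR_gt0 (R : realType) (a x : R) : 0 < x ->
  {for x, continuous (fun t : R => t `^ a)}.
Proof.
move=> x0; apply: differentiable_continuous; apply/derivable1_diffP.
by apply: derivable_powR; rewrite in_itv/= andbT.
Qed.

Section sublevel_asymptotics.
Context {R : realType} {n : nat} (f q : 'rV[R]_n.+1 -> R) (x : 'rV[R]_n.+1).
Hypotheses (cf : continuous f)
  (gf : f x / ln (1 + enorm x) @[x --> enorm_infty] --> +oo).
Hypotheses (cq : continuous q) (qZ : forall t v, q (t *: v) = t ^+ 2 * q v).
Variables (m : R) (m0 : 0 < m) (qm : forall v, m * `|v| ^+ 2 <= q v).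
Hypothesis fq : forall e : R, 0 < e -> exists2 r : R, 0 < r &
  forall h, `|h| < r -> `|f (x + h) - q h| <= e * q h.
Hypothesis isolated : forall r : R, 0 < r -> exists2 s : R, 0 < s &
  forall y, r <= `|y - x| -> s <= f y.

Local Notation a := (n.+1%:R / 2 : R).
Local Notation V := (sublevel_volume f).
Local Notation c := (sublevel_volume q 1).

Lemma sublevel_fin_num s : lebesgue_rV n.+1 [set y | f y <= s] \is a fin_num.
Proof.
have [C C0 CP] := sublevel_measure_growth cf gf.
rewrite ge0_fin_numE//.
apply: (@le_lt_trans _ _ (C * expR (Num.max s 0))%:E); last exact: ltry.
apply: le_trans (CP _ _); last by rewrite le_max lexx orbT.
apply: le_measure; rewrite ?inE.
- by apply: measurable_sublevel; exact: continuous_measurable_rV.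
- by apply: measurable_sublevel; exact: continuous_measurable_rV.
- by move=> y /= ys; rewrite le_max ys.
Qed.

(** After translation to [x], the sublevel set of [f] at level [s] lies between those of [q] at
    levels [s / (1 + e)] and [s / (1 - e)], whose volumes are known by scaling. *)
Lemma sublevel_sandwich (e : R) : 0 < e < 1 -> exists2 s0 : R, 0 < s0 &
  forall s : R, 0 < s < s0 ->
    c * (1 + e)^-1 `^ a <= V s / s `^ a <= c * (1 - e)^-1 `^ a.
Proof.
move=> /andP[e0 e1]; have [r r0 rP] := fq e0; have [s1 s10 s1P] := isolated r0.
have qge0 h : 0 <= q h by apply: le_trans (qm h); rewrite mulr_ge0 ?sqr_ge0// ltW.
(* Below [s1] the sublevel set of [f], and below [m * r ^+ 2] that of [q], lies within radius [r],
   where [fq] applies. *)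
exists (Num.min s1 (m * r ^+ 2)) => [|s /andP[s0]].
  by rewrite lt_min s10 mulr_gt0// exprn_gt0.
rewrite lt_min => /andP[ss1 smr].
have sa0 : 0 < s `^ a by rewrite powR_gt0.
have e10 : 0 < 1 + e by rewrite addr_gt0.
have e20 : 0 < 1 - e by rewrite subr_gt0.
have E (t : R) : 0 < t -> c * t^-1 `^ a * s `^ a = sublevel_volume q (s / t).
  move=> t0; rewrite (quad_sublevel_scale cq qZ m0 qm (divr_gt0 s0 t0)).
  by rewrite powRM ?(ltW s0) ?invr_ge0 ?(ltW t0)//; ring.
rewrite ler_pdivlMr// ler_pdivrMr// !E//.
(* Translation invariance, the affine lemma with ratio 1, moves the minimizer to the origin. *)
have tr : lebesgue_rV n.+1 [set y | f y <= s] = lebesgue_rV n.+1 [set h | f (x + h) <= s].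
  rewrite -(@lebesgue_rV_affine _ _ x 1)//; last first.
    by apply: measurable_sublevel; exact: continuous_measurable_rV.
  rewrite expr1n mul1e; congr (lebesgue_rV _ _).
  by apply/seteqP; split => y /=; rewrite scale1r.
have mf : measurable_fun setT (fun h => f (x + h)).
  apply: continuous_measurable_rV => h; apply: continuous_comp; last exact: cf.
  by apply: (@continuousD R); [exact: cst_continuous|exact: cvg_id].
have mq := continuous_measurable_rV cq.
have ff : lebesgue_rV n.+1 [set h | f (x + h) <= s] \is a fin_num.
  by rewrite -tr sublevel_fin_num.
have qf t : 0 < t -> lebesgue_rV n.+1 [set h | q h <= s / t] \is a fin_num.
  by move=> t0; apply: (quad_sublevel_fin_num cq m0 qm); exact: ltW (divr_gt0 s0 t0).
rewrite /sublevel_volume tr; apply/andP; split; apply: fine_le;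
  rewrite ?ff ?qf//; apply: le_measure; rewrite ?inE;
  [exact: measurable_sublevel|exact: measurable_sublevel|
  |exact: measurable_sublevel|exact: measurable_sublevel|].
- move=> h /= qh; have hr : `|h| < r.
    rewrite -(@ltr_pXn2r _ 2)// ?nnegrE//; last exact: ltW.
    rewrite -(ltr_pM2l m0).
    apply: le_lt_trans smr; apply: (le_trans (qm h)); apply: (le_trans qh).
    by rewrite ler_pdivrMr// ler_pMr// lerDl ltW.
  have := rP h hr; rewrite ler_norml => /andP[_].
  rewrite lerBlDr => H; apply: (le_trans H).
  by move: qh; rewrite ler_pdivlMr// mulrDr mulr1 addrC mulrC.
- move=> h /= fh; have hr : `|h| < r.
    rewrite ltNge; apply/negP => rh.
    have := s1P (x + h); rewrite addrAC subrr add0r => /(_ rh).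
    by rewrite leNgt (le_lt_trans fh).
  have := rP h hr; rewrite ler_norml => /andP[+ _].
  rewrite ler_pdivlMr// mulrBr mulr1 lerBrDr addrC => H.
  by rewrite mulrC (le_trans H).
Qed.

Lemma sublevel_volume_cvg : V s / s `^ a @[s --> 0^'+] --> c.
Proof.
apply/cvgrPdist_le => e e0.
have [d /andP[d0 d1] [H1 H2]] : exists2 d : R, 0 < d < 1 &
    `|c - c * (1 + d)^-1 `^ a| <= e /\ `|c - c * (1 - d)^-1 `^ a| <= e.
  (* The values 1 and -1 of [t] give the lower and the upper bound of the sandwich. *)
  have C (t : R) : c * (1 + t * d)^-1 `^ a @[d --> 0^'+] --> c.
    suff H : (1 + t * d)^-1 `^ a @[d --> 0^'+] --> (1 + t * 0)^-1 `^ a.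
      move: H; rewrite mulr0 addr0 invr1 powR1 => H.
      rewrite -[X in _ --> X]mulr1; apply: cvgM => //; exact: cvg_cst.
    apply: (@continuous_cvg _ _ _ _ _ _ (fun u : R => u `^ a)).
      by apply: continuous_powR_gt0; rewrite mulr0 addr0 invr1.
    apply: cvgV; first by rewrite mulr0 addr0 oner_neq0.
    apply: cvgD; first exact: cvg_cst.
    apply: cvgM; first exact: cvg_cst.
    exact/cvg_at_right_filter/cvg_id.
  have /cvgrPdist_le/(_ _ e0) C1 := C 1.
  have /cvgrPdist_le/(_ _ e0) C2 := C (-1).
  near (0 : R)^'+ => d; exists d.
    by apply/andP; split; near: d; [exact: nbhs_right_gt|exact: nbhs_right_lt].
  split.
    by near: d; move: C1; apply: filterS => d; rewrite mul1r.
  by near: d; move: C2; apply: filterS => d; rewrite mulN1r.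
have d01 : 0 < d < 1 by rewrite d0.
have [s0 s00 sP] := sublevel_sandwich d01.
near=> s.
have /sP/andP[L U] : 0 < s < s0.
  by apply/andP; split; near: s; [exact: nbhs_right_gt|exact: nbhs_right_lt].
move: H1 H2; rewrite !ler_norml => /andP[_ H1] /andP[H2 _].
by apply/andP; split; lra.
Unshelve. all: by end_near. Qed.

(** Supplies the domination for the Laplace integral. Small levels are covered by the sandwich with
    error 1/2, large ones by exponential growth. *)
Lemma sublevel_volume_bound : exists2 C : R, 0 < C &
  forall s : R, 0 < s -> V s <= C * s `^ a * expR s.
Proof.
have e01 : 0 < (2^-1 : R) < 1 by apply/andP; split; lra.
have [s0 s00 sP] := sublevel_sandwich e01.
have [C C0 CP] := sublevel_measure_growth cf gf.
pose c' := c * (1 - 2^-1)^-1 `^ a.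
have c0 : 0 <= c by rewrite fine_ge0.
have c'0 : 0 <= c' by rewrite mulr_ge0 ?powR_ge0.
(* The first term serves [s < s0]; the second serves [s0 <= s], where the power of [s] is at least
   that of [s0]. *)
exists (c' + C / s0 `^ a) => [|s s_gt0].
  by rewrite ltr_wpDl// divr_gt0// powR_gt0.
have sa0 : 0 < s `^ a by rewrite powR_gt0.
have es : 1 <= expR s by rewrite -expR0 ler_expR ltW.
have [ss0|s0s] := ltP s s0.
  have /sP/andP[_] : 0 < s < s0 by rewrite s_gt0.
  rewrite ler_pdivrMr// -/c' => H; apply: (le_trans H).
  rewrite -[leLHS]mulr1 ler_pM// ?mulr_ge0 ?powR_ge0//.
  by rewrite ler_wpM2r ?powR_ge0// lerDl divr_ge0// ?powR_ge0// ltW.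
have := CP s (ltW s_gt0).
rewrite -(fineK (sublevel_fin_num s)) lee_fin => H; apply: (le_trans H).
rewrite ler_wpM2r ?expR_ge0// mulrDl ler_wpDl ?mulr_ge0 ?powR_ge0//.
rewrite -mulrA ler_pMr// ler_pdivlMl ?powR_gt0// mulr1.
by rewrite ge0_ler_powR// ?nnegrE// ltW.
Qed.

End sublevel_asymptotics.

(** * Laplace asymptotics of the partition function *)

Lemma integral_expRN_itvcy (R : realType) (a : R) :
  (\int[lebesgue_measure]_(t in `[a, +oo[) (expR (- t))%:E = (expR (- a))%:E)%E.
Proof.
have cE : continuous (fun t : R => expR (- t)).
  move=> t; apply: (@continuous_comp _ _ _ -%R (@expR R)); first exact: oppr_continuous.
  exact: continuous_expR.
have D (t : R) : is_derive t (1 : R) (fun u : R => - expR (- u)) (expR (- t)).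
  by apply: is_derive_eq; rewrite -[LHS]/(- (expR (- t) * - 1)) mulrN1 opprK.
rewrite (@ge0_continuous_FTC2y _ _ (fun u => - expR (- u)) _ 0).
- by rewrite EFinN oppeK add0e.
- by move=> t _; exact: expR_ge0.
- exact: continuous_subspaceT.
- by rewrite -oppr0; apply: cvgN; exact: cvgr_expR.
- by move=> t _; exact: ex_derive.
- by apply: cvgN; apply: cvg_at_right_filter; exact: cE.
- by move=> t _; rewrite derive1E derive_val.
Qed.

(** The weight at [x] is the integral of [expR (- t)] over [t] beyond [f x / rho]; Tonelli exchanges
    the two integrals. *)
Lemma layer_cake_expR d (T : measurableType d) (R : realType)
    (mu : {sigma_finite_measure set T -> \bar R}) (f : T -> R) (rho : R) :
  measurable_fun setT f -> (forall x, 0 <= f x) -> 0 < rho ->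
  (\int[mu]_x (expR (- f x / rho))%:E =
   \int[lebesgue_measure]_(t in `]0%R, +oo[)
     (mu [set x | (f x <= rho * t)%R] * (expR (- t))%:E))%E.
Proof.
move=> mf f0 rho0.
(* Its slice at fixed [x] is a half-line starting at [f x / rho], its slice at fixed positive [t] a
   sublevel set. *)
pose A : set (T * measurableTypeR R) := [set p | 0 < p.2] `&` [set p | f p.1 <= rho * p.2].
have mA : measurable A.
  apply: measurableI.
    rewrite (_ : [set p | _] = snd @^-1` `]0, +oo[%classic).
      by rewrite -[X in measurable X]setTI; exact: measurable_snd.
    by apply/seteqP; split => p /=; rewrite in_itv/= andbT.
  rewrite (_ : [set p | _] = [set p : T * measurableTypeR R | f p.1 - rho * p.2 <= 0]).
    apply: measurable_sublevel; apply: measurable_funB.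
      exact: (measurableT_comp mf measurable_fst).
    by apply: measurable_funM => //; exact: measurable_snd.
  by apply/seteqP; split => p /=; rewrite subr_le0.
pose F (p : T * measurableTypeR R) : \bar R := (\1_A p * expR (- p.2))%:E.
have mF : measurable_fun setT F.
  apply/measurable_EFinP; apply: measurable_funM; first exact: measurable_indic.
  have m1 : measurable_fun setT (fun t : measurableTypeR R => expR (- t)).
    exact: measurableT_comp.
  exact: (measurableT_comp m1 measurable_snd).
have F0 p : (0 <= F p)%E by rewrite lee_fin mulr_ge0// expR_ge0.
have mE (D : set (measurableTypeR R)) : measurable_fun D (fun t : measurableTypeR R => (expR (- t))%:E).
  apply/measurable_EFinP; apply: measurable_funTS; exact: measurableT_comp.
transitivity (\int[mu]_x \int[lebesgue_measure]_t F (x, t))%E.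
  apply: eq_integral => x _.
  pose S : set R := [set t | 0 < t /\ f x <= rho * t].
  transitivity (\int[lebesgue_measure]_(t in S) (expR (- t))%:E)%E; last first.
    rewrite integral_mkcond; apply: eq_integral => t _.
    rewrite /patch /F indicE /=; case: ifPn => [|/negP] tS.
      by rewrite (_ : _ \in A) ?mul1r//; rewrite inE in tS; rewrite inE.
    rewrite (_ : (_ \in A) = false) ?mul0r//; apply/negP => H; apply: tS.
    by rewrite inE in H; rewrite inE.
  rewrite mulNr; have [fx0|fx0] := ltP 0 (f x).
    rewrite (_ : S = `[f x / rho, +oo[%classic) ?integral_expRN_itvcy//.
    apply/seteqP; split => t /=; rewrite in_itv/= andbT ler_pdivrMr// mulrC.
      by case.
    move=> ft; split=> //.
    by rewrite -(pmulr_rgt0 _ rho0) (lt_le_trans fx0).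
  (* At a zero of [f] the slice is the open half-line, which differs from the closed one by a null
     set. *)
  have -> : f x = 0 by apply/eqP; rewrite eq_le fx0 f0.
  rewrite (_ : S = `]0, +oo[%classic).
    by rewrite mul0r -integral_expRN_itvcy; apply/esym/integral_itv_obnd_cbnd; exact: mE.
  apply/seteqP; split => t /=; rewrite in_itv/= andbT; first by case.
  by move=> t0; split=> //; rewrite (le_trans fx0)// mulr_ge0 // ltW.
rewrite (fubini_tonelli F)// [RHS]integral_mkcond.
apply: eq_integral => t _; rewrite /patch; case: ifPn => [|/negP] tS; last first.
  apply: integral0_eq => x _; rewrite /F indicE (_ : (_ \in A) = false) ?mul0r//.
  by apply/negP; rewrite inE => -[/= t0 _]; apply: tS; rewrite inE/= in_itv/= t0.
have t0 : 0 < t by move: tS; rewrite inE/= in_itv/= andbT.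
have mS : measurable [set x | f x <= rho * t] by exact: measurable_sublevel.
transitivity (\int[mu]_x ((\1_[set x | (f x <= rho * t)%R] x)%:E * (expR (- t))%:E))%E.
  apply: eq_integral => x _; rewrite /F -EFinM; congr (_ * _)%:E; rewrite !indicE.
  by congr ((nat_of_bool _)%:R); apply/idP/idP; rewrite !inE; [case|move=> ?; split].
rewrite ge0_integralZr ?lee_fin ?expR_ge0//.
  by rewrite integral_indic// setIT.
exact/measurable_EFinP/measurable_indic.
Qed.

(** Raise [u <= expR u], for [u = t / (4 * a)], to the power [a]. *)
Lemma powR_le_expR (R : realType) (a t : R) : 0 < a -> 0 < t ->
  t `^ a <= (4 * a) `^ a * expR (t / 4).
Proof.
move=> a0 t0; have a40 : 0 < 4 * a by rewrite mulr_gt0.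
have -> : t `^ a = (4 * a) `^ a * (t / (4 * a)) `^ a.
  by rewrite -powRM ?(ltW a40) ?divr_ge0 ?(ltW t0) ?(ltW a40)// mulrCA divff ?mulr1 ?gt_eqF.
rewrite ler_wpM2l ?powR_ge0//.
have -> : expR (t / 4) = expR (t / (4 * a)) `^ a.
  rewrite /powR gt_eqF ?expR_gt0// expRK; congr expR.
  by field; rewrite gt_eqF.
rewrite ge0_ler_powR ?nnegrE ?(ltW a0) ?expR_ge0 ?divr_ge0 ?(ltW t0) ?(ltW a40)//.
by rewrite (le_trans _ (expR_ge1Dx _))// lerDr.
Qed.

Section gamma_integral.
Context {R : realType} (a : R) (a0 : 0 < a).
Local Notation D := `]0%R, +oo[%classic.
Local Notation leb := (@lebesgue_measure R).

(** A multiple of the exponential density of rate 1/4, so that integrability is inherited from it;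
    the factor 4 cancels the rate in the density. *)
Definition gamma_majorant (t : R) : R := 4 * (4 * a) `^ a * exponential_pdf 4^-1 t.

(** Only half of the exponential decay is used: in [laplace_cvg] the other half pays for the factor
    [expR] in the bound on [V]. *)
Lemma gamma_majorantP t : 0 < t -> t `^ a * expR (- t / 2) <= gamma_majorant t.
Proof.
move=> t0; rewrite /gamma_majorant exponential_pdfE ?(ltW t0)//.
have -> : 4 * (4 * a) `^ a * (4^-1 * expR (- 4^-1 * t)) =
    (4 * a) `^ a * expR (t / 4) * expR (- t / 2).
  rewrite -[RHS]mulrA -expRD; have -> : t / 4 + - t / 2 = - 4^-1 * t by lra.
  by field.
by rewrite ler_wpM2r ?expR_ge0// powR_le_expR.
Qed.

Lemma gamma_majorant_integrable : leb.-integrable D (EFin \o gamma_majorant).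
Proof.
rewrite (_ : EFin \o gamma_majorant =
    fun t => ((4 * (4 * a) `^ a)%:E * (exponential_pdf 4^-1 t)%:E)%E); last first.
  by apply/funext => t; rewrite /= EFinM.
apply: integrableZl => //; apply: (@integrableS _ _ _ _ setT) => //.
by apply: integrable_exponential_pdf; rewrite invr_gt0.
Qed.

Lemma measurable_gamma_integrand (E : set R) :
  measurable_fun E (fun t : R => t `^ a * expR (- t)).
Proof.
apply: measurable_funTS; apply: measurable_funM; first exact: measurable_powR.
exact: measurableT_comp.
Qed.

Lemma gamma_integrable : leb.-integrable D (EFin \o (fun t => t `^ a * expR (- t))).
Proof.
apply: le_integrable gamma_majorant_integrable => //.
  by apply/measurable_EFinP; exact: measurable_gamma_integrand.
move=> t /=; rewrite in_itv/= andbT => t0; rewrite lee_fin.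
rewrite ger0_norm ?mulr_ge0 ?powR_ge0 ?expR_ge0//.
apply: le_trans (ler_norm _); apply: le_trans (gamma_majorantP t0).
by rewrite ler_wpM2l ?powR_ge0// ler_expR; lra.
Qed.

Lemma euler_gammaE :
  (euler_gamma (a + 1))%:E = (\int[leb]_(t in D) (t `^ a * expR (- t))%:E)%E.
Proof.
rewrite /euler_gamma /Rintegral addrK fineK//.
exact: integrable_fin_num gamma_integrable.
Qed.

(** On [1, 2] the integrand is at least [expR (- 2)]. *)
Lemma euler_gamma_gt0 : 0 < euler_gamma (a + 1).
Proof.
rewrite -lte_fin euler_gammaE.
apply: (@lt_le_trans _ _ (\int[leb]_(t in `[1%R, 2%R]) (expR (- 2))%:E)%E).
  rewrite integral_cst//= lebesgue_measure_itv/= lte_fin ltr1n -EFinD -EFinM lte_fin.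
  by rewrite mulr_gt0 ?expR_gt0//; lra.
apply: (@le_trans _ _ (\int[leb]_(t in `[1%R, 2%R]) (t `^ a * expR (- t))%:E)%E).
  apply: ge0_le_integral => //.
    by apply/measurable_EFinP; exact: measurable_gamma_integrand.
  move=> t /=; rewrite in_itv/= => /andP[t1 t2]; rewrite lee_fin -[leLHS]mul1r.
  rewrite ler_pM// ?expR_ge0//; last by rewrite ler_expR lerN2.
  by rewrite -(powRr0 t) ler_powR// ltW.
apply: ge0_subset_integral => //.
- by apply/measurable_EFinP; exact: measurable_gamma_integrand.
- by move=> t _; rewrite lee_fin mulr_ge0 ?powR_ge0 ?expR_ge0.
- by move=> t /=; rewrite !in_itv/= andbT => /andP[t1 _]; rewrite (lt_le_trans ltr01).
Qed.

End gamma_integral.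

(* Abelian theorem for the Laplace transform: dominated convergence after the
   substitution [s = rho * t]. *)
Lemma laplace_cvg (R : realType) (a c C : R) (V : R -> R) : 0 < a -> 0 <= C ->
  (forall s, 0 <= V s) -> {homo V : s t / s <= t} ->
  V s / s `^ a @[s --> 0^'+] --> c ->
  (forall s, 0 < s -> V s <= C * s `^ a * expR s) ->
  (\int[lebesgue_measure]_(t in `]0%R, +oo[)
    (V (rho * t) / rho `^ a * expR (- t))%:E)%E @[rho --> 0^'+] -->
  (c * euler_gamma (a + 1))%:E.
Proof.
move=> a0 C0 V0 Vnd Vc VC.
(* Dominated convergence concerns sequences, so the limit is tested along positive sequences tending
   to 0. *)
apply/cvge_at_rightP => u [u0 uc].
rewrite EFinM (euler_gammaE a0) -integralZl//; last exact: gamma_integrable.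
have half0 : 0 < 2^-1 :> R by rewrite invr_gt0.
(* Truncation at 1/2 changes only finitely many terms and makes [expR (w k * t - t)] at most
   [expR (- t / 2)] for every [k], as the majorant demands. *)
pose w k := Num.min (u k) 2^-1.
have w0 k : 0 < w k by rewrite lt_min u0 half0.
have wh k : w k <= 2^-1 by rewrite ge_min lexx orbT.
have uw : \forall k \near \oo, w k = u k.
  have /cvgrPdist_lt/(_ _ half0) := uc.
  apply: filterS => k; rewrite sub0r normrN (gtr0_norm (u0 k)) => H.
  by rewrite /w; apply/min_idPl/ltW.
have wc : w k @[k --> \oo] --> (0 : R).
  apply: cvg_trans uc; apply: near_eq_cvg; apply: filterS uw => k ->//.
pose G k (t : R) := (V (w k * t) / w k `^ a * expR (- t))%:E.
suff H : (\int[lebesgue_measure]_(t in `]0%R, +oo[) G k t)%E @[k --> \oo] -->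
    (\int[lebesgue_measure]_(t in `]0%R, +oo[) (c%:E * (t `^ a * expR (- t))%:E))%E.
  by apply: cvg_trans H; apply: near_eq_cvg; apply: filterS uw => k; rewrite /G => ->.
have mV (r : R) : 0 < r -> measurable_fun setT (fun t : R => V (r * t)).
  move=> r0; apply: nondecreasing_measurable => // s t st.
  by apply: Vnd; rewrite ler_pM2l.
have [] := @dominated_convergence _ _ _ lebesgue_measure `]0%R, +oo[%classic _ G
   (fun t => (c%:E * (t `^ a * expR (- t))%:E)%E)
   (EFin \o (fun t => C * gamma_majorant a t)) => //.
- move=> k; apply/measurable_EFinP; apply: measurable_funTS.
  apply: measurable_funM; last exact: measurableT_comp.
  by apply: measurable_funM => //; exact: mV.
- apply: measurable_funeM; apply/measurable_EFinP; exact: measurable_gamma_integrand.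
- apply: aeW => t /=; rewrite in_itv/= andbT => t0.
  rewrite /G -EFinM; apply: cvg_EFin; first exact: nearW.
  rewrite [X in X @ _ --> _](_ : _ = fun k => V (w k * t) / (w k * t) `^ a * (t `^ a * expR (- t))).
    apply: cvgM; last exact: cvg_cst.
    have /cvg_at_rightP/(_ (fun k => w k * t)) := Vc; apply; split.
      by move=> k; rewrite mulr_gt0.
    by rewrite -(mul0r t); apply: cvgM => //; exact: cvg_cst.
  apply/funext => k /=; rewrite powRM ?(ltW (w0 k)) ?(ltW t0)//.
  by field; rewrite !gt_eqF ?powR_gt0.
- rewrite (_ : EFin \o _ = fun t => (C%:E * (EFin \o gamma_majorant a) t)%E); last first.
    by apply/funext => t; rewrite /= EFinM.
  by apply: integrableZl => //; exact: gamma_majorant_integrable.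
- apply: aeW => t k /=; rewrite in_itv/= andbT => t0; rewrite lee_fin.
  have wt0 : 0 < w k * t by rewrite mulr_gt0.
  have wa0 : 0 < w k `^ a by rewrite powR_gt0.
  rewrite ger0_norm; last by rewrite !mulr_ge0// ?expR_ge0// invr_ge0 ltW.
  apply: (@le_trans _ _ (C * (t `^ a * expR (- t / 2)))); last first.
    by rewrite ler_wpM2l// gamma_majorantP.
  apply: (@le_trans _ _ (C * (w k * t) `^ a * expR (w k * t) / w k `^ a * expR (- t))).
    by rewrite ler_wpM2r ?expR_ge0// ler_wpM2r ?invr_ge0 ?(ltW wa0)// VC.
  rewrite powRM ?(ltW (w0 k)) ?(ltW t0)//.
  have -> : C * (w k `^ a * t `^ a) * expR (w k * t) / w k `^ a * expR (- t) =
      C * (t `^ a * (expR (w k * t) * expR (- t))).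
    by field; rewrite gt_eqF.
  rewrite ler_wpM2l// ler_wpM2l ?powR_ge0// -expRD ler_expR.
  have := ler_wpM2r (ltW t0) (wh k); lra.
Qed.

(** * Gibbs probability of the sublevel set *)

Lemma fineZ_gt0 (R : realType) (r : R) (x : \bar R) : 0 < r ->
  fine (r%:E * x)%E = r * fine x.
Proof.
move=> r0; case: x => [x||] /=; first by [].
  by rewrite gt0_muley ?lte_fin//= mulr0.
by rewrite gt0_muleNy ?lte_fin//= mulr0.
Qed.

Lemma rho_eps_gt0 (R : realType) d (kappa e : R) : 0 < kappa -> 0 < e ->
  0 < rho_eps d kappa e.
Proof. by move=> k0 e0; rewrite mulr_gt0// powR_gt0. Qed.

Section gibbs_asymptotics.
Context {R : realType} {d : nat} (f : 'rV[R]_d -> R) (kappa : R).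
Hypotheses (d2 : (2 < d)%N) (kappa0 : 0 < kappa).
Hypotheses (mf : measurable_fun setT f) (f0 : forall x, 0 <= f x).
Hypothesis ffin : forall s, lebesgue_rV d [set x | f x <= s] \is a fin_num.
Local Notation a := (d%:R / 2 : R).
Local Notation V := (sublevel_volume f).
Local Notation Z := (partition_function f).
Local Notation rho := (rho_eps d kappa).
Variables (c C : R) (c0 : 0 < c) (C0 : 0 <= C).
Hypothesis Vc : V s / s `^ a @[s --> 0^'+] --> c.
Hypothesis VC : forall s : R, 0 < s -> V s <= C * s `^ a * expR s.

Let d0 : 0 < d%:R :> R. Proof. by rewrite ltr0n (leq_trans _ d2). Qed.
Let a0 : 0 < a. Proof. by rewrite divr_gt0. Qed.

Let mexp r E : measurable_fun E (fun x => (expR (- f x / r))%:E).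
Proof.
apply/measurable_EFinP; apply: measurable_funTS; apply: measurableT_comp => //.
by apply: measurable_funM => //; exact: measurable_funN.
Qed.

Let V0 s : 0 <= V s. Proof. by rewrite fine_ge0. Qed.

Let Vnd : {homo V : s t / s <= t}.
Proof.
move=> s t st; apply: fine_le; rewrite ?ffin//.
apply: le_measure; rewrite ?inE; [exact: measurable_sublevel|exact: measurable_sublevel|].
by move=> y /= /le_trans; apply.
Qed.

(** By the layer-cake formula the normalized partition function is the integral of [laplace_cvg]. *)
Lemma partition_function_cvg :
  Z r / r `^ a @[r --> 0^'+] --> c * euler_gamma (a + 1).
Proof.
refine (cvg_trans _ (fine_cvg (laplace_cvg a0 C0 V0 Vnd Vc VC))).
apply: near_eq_cvg; near=> r.
have r0 : 0 < r by near: r; exact: nbhs_right_gt.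
rewrite /partition_function /Rintegral layer_cake_expR//= [RHS]mulrC.
rewrite -fineZ_gt0 ?invr_gt0 ?powR_gt0//; congr fine.
have mV : measurable_fun (`]0, +oo[%classic : set R) (fun t : R => V (r * t) * expR (- t)).
  apply: measurable_funM; last by apply: measurable_funTS; exact: measurableT_comp.
  apply: nondecreasing_measurable => // s t st.
  by apply: Vnd; rewrite ler_pM2l.
rewrite -ge0_integralZl ?lee_fin ?invr_ge0 ?powR_ge0//.
- apply: eq_integral => t _; rewrite -(fineK (ffin (r * t))) -!EFinM.
  by congr EFin; rewrite -/(V (r * t)); ring.
- rewrite (_ : (fun _ => _) = EFin \o (fun t : R => V (r * t) * expR (- t))).
    exact/measurable_EFinP.
  by apply/funext => t /=; rewrite -(fineK (ffin _)) EFinM.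
- by move=> t _; rewrite mule_ge0// lee_fin expR_ge0.
Unshelve. all: by end_near. Qed.

(** On the set the weight lies between [expR (- e / r)] and 1. The witness [N] records that the
    integral is finite. *)
Lemma gibbs_sublevel_numerator e r : 0 < e -> 0 < r ->
  exists2 N : R, (\int[lebesgue_rV d]_(x in [set y | (f y <= e)%R]) (expR (- f x / r))%:E)%E = N%:E
    & expR (- e / r) * V e <= N <= V e.
Proof.
move=> e0 r0; set A := [set y | f y <= e].
have mA : measurable A by exact: measurable_sublevel.
set I := (\int[lebesgue_rV d]_(x in A) _)%E.
have VE : lebesgue_rV d A = (V e)%:E by rewrite fineK.
have U : (I <= (V e)%:E)%E.
  rewrite -VE -[leRHS]mul1e -(integral_cst (lebesgue_rV d) mA 1).
  rewrite /I; apply: ge0_le_integral => //.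
  move=> x _; rewrite lee_fin -expR0 ler_expR mulNr oppr_le0 divr_ge0//.
  exact: ltW.
have L : ((expR (- e / r) * V e)%:E <= I)%E.
  rewrite EFinM -VE -(integral_cst (lebesgue_rV d) mA).
  rewrite /I; apply: ge0_le_integral => //.
    by move=> x _; rewrite lee_fin expR_ge0.
  move=> x Ax; rewrite lee_fin ler_expR ler_pM2r ?invr_gt0// lerN2.
  exact: Ax.
have fI : I \is a fin_num.
  rewrite ge0_fin_numE; first exact: le_lt_trans U (ltry _).
  by apply: le_trans L; rewrite lee_fin mulr_ge0 ?expR_ge0.
exists (fine I); first by rewrite fineK.
by rewrite -!lee_fin fineK// L.
Qed.

(** The exponent [1 - 2 / d] is positive because [d] exceeds 2. *)
Lemma rho_eps_cvg0 : rho e @[e --> 0^'+] --> (0 : R).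
Proof.
rewrite -[X in _ --> X](mulr0 kappa); apply: cvgM; first exact: cvg_cst.
apply: powR_cvg0; rewrite subr_gt0 ltr_pdivrMr// mul1r.
by rewrite (ltr_nat _ 2).
Qed.

Lemma gibbs_sublevel_cvg :
  fine (gibbs f (rho e) [set y | f y <= e]) / (e / K_const d kappa)
    @[e --> 0^'+] --> (1 : R).
Proof.
have g0 : 0 < euler_gamma (a + 1) by exact: euler_gamma_gt0.
pose N e := fine (\int[lebesgue_rV d]_(x in [set y | (f y <= e)%R]) (expR (- f x / rho e))%:E)%E.
have Nc : N e / e `^ a @[e --> 0^'+] --> c.
  have ec : expR (- e / rho e) * (V e / e `^ a) @[e --> 0^'+] --> c.
    rewrite -[X in _ --> X]mul1r; apply: cvgM => //.
    rewrite -[X in _ --> X]expR0; apply: (@continuous_cvg _ _ _ _ _ _ expR).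
      exact: continuous_expR.
    (* The quotient of [e] by [rho e] is this power of [e] divided by [kappa], so the exponential
       lower bound on the weight tends to 1. *)
    have : - (e `^ (2 / d%:R) / kappa) @[e --> 0^'+] --> (0 : R).
      rewrite -[X in _ --> X]oppr0; apply: cvgN.
      rewrite -[X in _ --> X](mul0r kappa^-1); apply: cvgM; last exact: cvg_cst.
      by apply: powR_cvg0; rewrite divr_gt0.
    apply: cvg_trans; apply: near_eq_cvg; near=> e.
    have e0 : 0 < e by near: e; exact: nbhs_right_gt.
    rewrite /rho_eps powRB; last by rewrite (gt_eqF e0) implybT.
    rewrite (powRr1 (ltW e0)).
    by field; rewrite !gt_eqF ?powR_gt0.
  apply: (squeeze_cvgr _ ec Vc); near=> e.
  have e0 : 0 < e by near: e; exact: nbhs_right_gt.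
  have [N' NE /andP[NL NU]] := gibbs_sublevel_numerator e0 (rho_eps_gt0 d kappa0 e0).
  rewrite /N NE /= mulrA.
  by rewrite !ler_wpM2r ?invr_ge0 ?powR_ge0.
(* Sequences are used to compose the limits, since [rho e] must tend to 0 through positive
   values. *)
have Zc : Z (rho e) / rho e `^ a @[e --> 0^'+] --> c * euler_gamma (a + 1).
  apply/cvg_at_rightP => u [u0 uc].
  have /cvg_at_rightP := partition_function_cvg; apply; split.
    by move=> k; exact: rho_eps_gt0.
  by have /cvg_at_rightP := rho_eps_cvg0; apply.
have : (N e / e `^ a) / (Z (rho e) / rho e `^ a) * euler_gamma (a + 1) @[e --> 0^'+] --> (1 : R).
  rewrite [X in _ --> X](_ : 1 = c / (c * euler_gamma (a + 1)) * euler_gamma (a + 1)); last first.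
    by field; rewrite !gt_eqF.
  apply: cvgM; last exact: cvg_cst.
  by apply: cvgM => //; apply: cvgV => //; rewrite gt_eqF// mulr_gt0.
apply: cvg_trans; apply: near_eq_cvg; near=> e.
have e0 : 0 < e by near: e; exact: nbhs_right_gt.
have [N' NE _] := gibbs_sublevel_numerator e0 (rho_eps_gt0 d kappa0 e0).
rewrite /N /gibbs NE /= /K_const.
(* Since [(1 - 2 / d) * (d / 2) = d / 2 - 1], one factor [e] survives in the quotient, which makes
   the probability linear in [e]. *)
have -> : rho e `^ a = kappa `^ a * (e `^ a / e).
  rewrite /rho_eps powRM ?powR_ge0 ?(ltW kappa0)//; congr (_ * _).
  rewrite -powRrM (_ : (1 - 2 / d%:R) * a = a - 1); last first.
    by field; rewrite gt_eqF.
  by rewrite powRB ?(gt_eqF e0) ?implybT// powRr1// ltW.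
(* If [Z] vanishes, both sides are 0 because the inverse of 0 is 0. *)
have [->|Z0] := eqVneq (Z (rho e)) 0; first by rewrite invr0 !(mul0r, mulr0, invr0).
by field; rewrite Z0 !gt_eqF ?powR_gt0.
Unshelve. all: by end_near. Qed.

End gibbs_asymptotics.

(** * Sample size *)

(** The minimum exceeds [e] exactly when every sample misses the sublevel set, and independence
    multiplies the probabilities. For [n = 0] the minimum is [+oo] and both sides are 1. *)
Lemma sample_min_tail (d d' : measure_display) (Omega : measurableType d)
    (T : measurableType d') (R : realType) (P : probability Omega R)
    (f : T -> R) (X : nat -> {RV P >-> T}) (law : set T -> \bar R) (e p : R) n :
  measurable_fun setT f -> iid X law -> law [set y | f y <= e] = p%:E ->
  P [set w | (e%:E < sample_min f X n w)%E] = ((1 - p) ^+ n)%:E.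
Proof.
move=> mf [idX indX] lawE.
have mA : measurable [set y | f y <= e] by exact: measurable_sublevel.
have mB : measurable (~` [set y | f y <= e]) by exact: measurableC.
have PB i : P (X i @^-1` (~` [set y | f y <= e])) = (1 - p)%:E.
  have mX : measurable (X i @^-1` [set y | f y <= e]).
    by rewrite -[X in measurable X]setTI; exact: measurable_funP.
  rewrite preimage_setC probability_setC//.
  by have := idX i _ mA; rewrite lawE /distribution /pushforward => ->; rewrite EFinB.
pose J := seq_fset tt (iota 0 n).
have -> : [set w | (e%:E < sample_min f X n w)%E] =
    \bigcap_(i in [set` J]) (X i @^-1` (~` [set y | f y <= e])).
  apply/seteqP; split => w /=.
    move=> /bigmin_gtP[_ H] i /=; rewrite seq_fsetE mem_iota => /andP[_ ni].
    have := H (Ordinal ni) isT; rewrite lte_fin ltNge.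
    by move/negP.
  move=> H; apply/bigmin_gtP; split=> [|i _]; first exact: ltry.
  rewrite lte_fin ltNge; apply/negP; apply: (H i).
  by rewrite /= seq_fsetE mem_iota/=.
rewrite (indX J (fun=> ~` [set y | f y <= e]))//.
rewrite (eq_bigr (fun=> (1 - p)%:E)); last by move=> i _; exact: PB.
rewrite prodEFin big_const_seq iter_mulr_1; congr ((_ ^+ _)%:E).
by rewrite count_predT -[LHS]/(#|` J|) size_seq_fset undup_id ?iota_uniq// size_iota.
Qed.

(** Taking logarithms, [n] suffices exactly when it is at least [ln (1 / dl) / - ln (1 - p)], so
    [nstar] is the ceiling of this number. *)
Lemma nstar_bounds (d d' : measure_display) (Omega : measurableType d)
    (T : measurableType d') (R : realType) (P : probability Omega R)
    (f : T -> R) (X : nat -> {RV P >-> T}) (law : set T -> \bar R) (e p dl : R) :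
  measurable_fun setT f -> iid X law -> law [set y | f y <= e] = p%:E ->
  0 < p < 1 -> 0 < dl < 1 ->
  ln (1 / dl) / - ln (1 - p) <= (nstar f X e dl)%:R <= ln (1 / dl) / - ln (1 - p) + 1.
Proof.
move=> mf iidX lawE /andP[p0 p1] /andP[dl0 dl1].
have q0 : 0 < 1 - p by rewrite subr_gt0.
have l0 : 0 < - ln (1 - p) by rewrite oppr_gt0 ln_lt0// q0/= ltrBlDr ltrDl.
have sufE n : sample_size_suffices f X e dl n <-> ln (1 / dl) / - ln (1 - p) <= n%:R.
  rewrite /sample_size_suffices (sample_min_tail n mf iidX lawE) lee_fin.
  rewrite ler_pdivrMr// div1r lnV ?posrE// mulrN lerN2 mulr_natl -lnXn//.
  by rewrite ler_ln ?posrE// exprn_gt0.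
have L0 : 0 < ln (1 / dl) by rewrite div1r ln_gt0// invf_gt1.
rewrite /nstar; case: pselect => [suff|]; last first.
  case; exists (Num.truncn (ln (1 / dl) / - ln (1 - p))).+1; apply/asboolP/sufE.
  by apply/ltW; exact: truncnS_gt.
case: ex_minnP => n /asboolP/sufE nP nmin; rewrite nP/=.
(* The threshold is positive, so 0 never suffices; otherwise the predecessor fails by minimality,
   which gives the upper bound. *)
case: n nP nmin => [|n] nP nmin.
  by move: nP; rewrite leNgt divr_gt0.
rewrite -natr1 lerD2r leNgt; apply/negP => /ltW/sufE/asboolP/nmin.
by rewrite ltnn.
Qed.

(** Both bounds come from [ln (1 + u) <= u], at [u = p / (1 - p)] and at [u = - p]. *)
Lemma ln1B_bounds (R : realType) (p : R) : 0 < p < 1 ->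
  1 - p <= p / - ln (1 - p) <= 1.
Proof.
move=> /andP[p0 p1].
have q0 : 0 < 1 - p by rewrite subr_gt0.
have l0 : 0 < - ln (1 - p) by rewrite oppr_gt0 ln_lt0// q0/= ltrBlDr ltrDl.
rewrite ler_pdivlMr// ler_pdivrMr// mul1r; apply/andP; split.
  have := @le_ln1Dx R (p / (1 - p)).
  have -> : 1 + p / (1 - p) = (1 - p)^-1 by field; rewrite gt_eqF.
  rewrite lnV ?posrE// => H; rewrite mulrC -ler_pdivlMr//; apply: H.
  by rewrite (lt_le_trans (_ : -1 < 0)) ?ltrN10// divr_ge0// ltW.
rewrite lerNr; apply: le_ln1Dx; lra.
Qed.

Lemma near_at_right0 (R : realType) T (F : set_system T) (u : T -> R) : Filter F ->
  (\forall z \near F, 0 < u z) -> u z @[z --> F] --> (0 : R) ->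
  u z @[z --> F] --> (0 : R)^'+.
Proof.
move=> FF u0 uc A /= HA; have := uc _ HA; apply: filterS2 u0 => z /= uz; exact.
Qed.

(** Divided by [K * L / e], with [L = ln (1 / dl)], the bounds of [nstar_bounds] become [r e] and
    [r e] plus the inverse of [K * L / e]. The first tends to 1 as [e] decreases to 0; the extra
    term, due to rounding up, vanishes because [L / e] diverges. *)
Lemma nstar_cvg (R : realType) (d' : measure_display) (T : measurableType d')
    (f : T -> R) (law : R -> set T -> \bar R) (K : R) (disp : measure_display)
    (Omega : R -> measurableType disp) (P : forall e : R, probability (Omega e) R)
    (X : forall e : R, nat -> {RV (P e) >-> T}) (F : set_system (R * R)) :
  measurable_fun setT f -> 0 < K ->
  fine (law e [set y | f y <= e]) / (e / K) @[e --> 0^'+] --> (1 : R) ->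
  (forall e, 0 < e -> iid (X e) (law e)) -> Filter F ->
  (\forall z \near F, 0 < z.1 /\ 0 < z.2 < 1) ->
  z.1 @[z --> F] --> (0 : R) ->
  ln (1 / z.2) / z.1 @[z --> F] --> +oo ->
  (nstar f (X z.1) z.1 z.2)%:R / (K * ln (1 / z.2) / z.1) @[z --> F] --> (1 : R).
Proof.
move=> mf K0 lawc iidX FF Fpos F1 FL.
pose p e := fine (law e [set y | f y <= e]).
(* The value is finite because the law is the distribution of a sample. *)
have lawE e : 0 < e -> law e [set y | f y <= e] = (p e)%:E.
  move=> e0; rewrite /p fineK//; have [idX _] := iidX e e0.
  rewrite -(idX 0%N _ (measurable_sublevel e mf)) fin_num_measure//.
  exact: measurable_sublevel.
have pc : p e @[e --> 0^'+] --> (0 : R).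
  have : p e / (e / K) * (e / K) @[e --> 0^'+] --> (1 * (0 / K) : R).
    apply: cvgM => //; apply: cvgM; last exact: cvg_cst.
    exact/cvg_at_right_filter/cvg_id.
  rewrite mul0r mulr0; apply: cvg_trans; apply: near_eq_cvg; near=> e.
  have e0 : 0 < e by near: e; exact: nbhs_right_gt.
  by rewrite divfK// gt_eqF// divr_gt0.
have p01 : \forall e \near (0 : R)^'+, 0 < p e < 1.
  near=> e; apply/andP; split.
    have e0 : 0 < e by near: e; exact: nbhs_right_gt.
    have : 0 < p e / (e / K).
      by near: e; apply: (cvgr_gt _ lawc).
    by rewrite pmulr_lgt0// invr_gt0 divr_gt0.
  by near: e; exact: (cvgr_lt _ pc).
pose r e := (e / K) / - ln (1 - p e).
have rc : r e @[e --> 0^'+] --> (1 : R).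
  (* [r e] splits into a logarithmic quotient, close to 1 since [p e] tends to 0, and the inverse of
     the quotient in the hypothesis on [law]. *)
  have : (p e / - ln (1 - p e)) / (p e / (e / K)) @[e --> 0^'+] --> (1 / 1 : R).
    apply: cvgM; last by apply: cvgV => //; exact: oner_neq0.
    have lc : 1 - p e @[e --> 0^'+] --> (1 : R).
      by rewrite -[X in _ --> X]subr0; apply: cvgB => //; exact: cvg_cst.
    apply: (squeeze_cvgr _ lc (cvg_cst (1 : R))).
    by apply: filterS p01 => e; exact: ln1B_bounds.
  rewrite divr1; apply: cvg_trans; apply: near_eq_cvg; near=> e.
  have e0 : 0 < e by near: e; exact: nbhs_right_gt.
  have /andP[p0 p1] : 0 < p e < 1 by near: e; exact: p01.
  have l0 : ln (1 - p e) != 0 by rewrite lt_eqF// ln_lt0//; lra.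
  by rewrite /r; field; rewrite l0 !gt_eqF.
have F1' : z.1 @[z --> F] --> (0 : R)^'+.
  by apply: near_at_right0 => //; apply: filterS Fpos => z [].
have rF : r z.1 @[z --> F] --> (1 : R) by exact: cvg_comp F1' rc.
have sF : r z.1 + (ln (1 / z.2) / z.1)^-1 / K @[z --> F] --> (1 : R).
  rewrite -[X in _ --> X]addr0; apply: cvgD => //.
  rewrite -[X in _ --> X](mul0r K^-1); apply: cvgM; last exact: cvg_cst.
  apply/gtr0_cvgV0 => //; apply: filterS Fpos => z [z1 /andP[z20 z21]].
  by rewrite divr_gt0// div1r ln_gt0// invf_gt1.
apply: (squeeze_cvgr _ rF sF).
have pF : \forall z \near F, 0 < p z.1 < 1 by exact: (F1' _ p01).
near=> z.
have [z1 z2] : 0 < z.1 /\ 0 < z.2 < 1 by near: z.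
have pz : 0 < p z.1 < 1 by near: z.
have /andP[nl nu] := nstar_bounds mf (iidX _ z1) (lawE _ z1) pz z2.
case/andP: (pz) => p0 p1; case/andP: z2 => z20 z21.
have L0 : 0 < ln (1 / z.2) by rewrite div1r ln_gt0// invf_gt1.
have D0 : 0 < K * ln (1 / z.2) / z.1 by rewrite divr_gt0// mulr_gt0.
have l0 : ln (1 - p z.1) != 0 by rewrite lt_eqF// ln_lt0//; lra.
rewrite ler_pdivlMr// ler_pdivrMr//; apply/andP; split.
  apply: le_trans nl; rewrite le_eqVlt; apply/orP; left; apply/eqP.
  by rewrite /r; field; rewrite l0 !gt_eqF.
apply: (le_trans nu); rewrite le_eqVlt; apply/orP; left; apply/eqP.
by rewrite /r; field; rewrite l0 !gt_eqF.
Unshelve. all: by end_near. Qed.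

Unset Implicit Arguments.
Set Strict Implicit.

Theorem proposition2p5 (R : realType) (d : nat) (Gamma : 'rV[R]_d -> R)
    (xstar : 'rV[R]_d) (kappa : R) :
  (2 < d)%N ->
  assumptionA Gamma ->
  unique_global_minimizer Gamma xstar ->
  posdef (hess Gamma xstar) ->
  Gamma xstar = min_value Gamma -> min_value Gamma = 0 ->
  0 < kappa ->
  fine (gibbs Gamma (rho_eps d kappa e) [set y | Gamma y <= e])
    / (e / K_const d kappa) @[e --> 0^'+] --> (1 : R)
  /\
  (forall (disp : measure_display) (Omega : R -> measurableType disp)
      (P : forall e : R, probability (Omega e) R)
      (X : forall e : R, nat -> {RV (P e) >-> 'rV[R]_d}),
    (forall e, 0 < e -> iid (X e) (gibbs Gamma (rho_eps d kappa e))) ->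
    forall F : set_system (R * R), Filter F ->
      (\forall z \near F, 0 < z.1 /\ 0 < z.2 < 1) ->
      z.1 @[z --> F] --> (0 : R) ->
      ln (1 / z.2) / z.1 @[z --> F] --> +oo ->
      (nstar Gamma (X z.1) z.1 z.2)%:R
        / (K_const d kappa * ln (1 / z.2) / z.1) @[z --> F] --> (1 : R)).
Proof.
move=> d2 [C2G [growthG _ _] _] uniqG pdH Gmin min0 kappa0.
have fx0 : Gamma xstar = 0 by rewrite Gmin.
have [xmin _] := uniqG.
have G0 y : 0 <= Gamma y by rewrite -fx0.
have [[cG _] _] := C2G.
have mG := continuous_measurable_rV cG.
have pi_cvg : fine (gibbs Gamma (rho_eps d kappa e) [set y | Gamma y <= e])
    / (e / K_const d kappa) @[e --> 0^'+] --> (1 : R).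
  (* The volume lemmas are stated in dimension [n.+1]; dimension 0 contradicts [2 < d]. *)
  case: d d2 Gamma xstar C2G growthG uniqG pdH xmin fx0 G0 cG mG {Gmin min0} =>
    // n d2 Gamma xstar C2G growthG uniqG pdH xmin fx0 G0 cG mG.
  have [m m0 mP] := posdef_coercive pdH.
  pose q (v : 'rV[R]_n.+1) : R := (v *m hess Gamma xstar *m v^T) ord0 ord0 / 2.
  have cq : continuous q.
    move=> v; rewrite /q; apply: (@cvgM _ _ (nbhs v)); last exact: cvg_cst.
    exact: quad_form_continuous.
  have qZ t v : q (t *: v) = t ^+ 2 * q v by rewrite /q quad_formZ mulrA.
  have m20 : 0 < m / 2 by rewrite divr_gt0.
  have qm v : m / 2 * `|v| ^+ 2 <= q v.
    by rewrite mulrAC /q ler_pM2r ?invr_gt0.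
  (* Coercivity of [q] turns the Taylor error, a multiple of the squared norm, into an error
     relative to [q h]. *)
  have Gq e : 0 < e -> exists2 r : R, 0 < r &
      forall h, `|h| < r -> `|Gamma (xstar + h) - q h| <= e * q h.
    move=> e0; have [r r0 rP] := C2_taylor_minimizer C2G xmin (mulr_gt0 e0 m20).
    exists r => // h /rP; rewrite fx0 subr0 => H; apply: (le_trans H).
    by rewrite -mulrA ler_pM2l.
  have iso r : 0 < r -> exists2 s : R, 0 < s &
      forall y, r <= `|y - xstar| -> s <= Gamma y.
    exact: minimizer_isolated.
  have [C C0 CP] := sublevel_volume_bound cG growthG cq qZ m20 qm Gq iso.
  apply: (gibbs_sublevel_cvg d2 kappa0 mG G0 _ (quad_sublevel_gt0 cq qZ m20 qm) (ltW C0) _ CP).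
    exact: sublevel_fin_num.
  have Vc := sublevel_volume_cvg cG growthG cq qZ m20 qm Gq iso.
  exact: Vc.
split=> // disp Omega P X iidX F FF Fpos F1 FL.
apply: (@nstar_cvg _ _ _ _ (fun e => gibbs Gamma (rho_eps d kappa e))) => //.
rewrite /K_const mulr_gt0 ?powR_gt0// euler_gamma_gt0//.
by rewrite divr_gt0// ltr0n (leq_trans _ d2).
Qed.
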